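(* Let $d\geq 2$, let $T_d$ be the $d$-regular rooted tree, let $G\leq\operatorname{Aut}(T_d)$ be a finitely generated self-replicating branch group with the weak subgroup induction property, and let $H$ be a finitely generated subgroup of $G$. Then $H$ is commensurable with one of $\{1\}$, $G$, $G^{(\times 2)}$, $\dots$, $G^{(\times d-1)}$.
   Context: $G^{(\times k)}$ denotes the direct product of $k$ copies of $G$. Two groups $G_1,G_2$ are commensurable if there are finite-index subgroups $H_i\leq G_i$ with $H_1\cong H_2$. The vertices of the $d$-regular rooted tree $T=T_d$ are identified with the words in $\{1,\dots,d\}^*$; the root is the empty word, the children of $v$ are $v1,\dots,vd$, and $\mathcal L_n$ is the set of words of length $n$. $\operatorname{Aut}(T)$ is the group of automorphisms of $T$ (fixing the root). For a vertex $v$, $T_v$ is the subtree of all words with prefix $v$. For $g\in\operatorname{Aut}(T)$ and a vertex $v$, the section $\varphi_v(g)\in\operatorname{Aut}(T)$ is the unique automorphism with $g\cdot(vw)=(g\cdot v)(\varphi_v(g)\cdot w)$ for all $w\in T$; $\varphi_v$ is a homomorphism on the stabilizer of $v$. For $G\leq\operatorname{Aut}(T)$ and a set $V$ of vertices, $\operatorname{Stab}_G(V)$ is the pointwise stabilizer of $V$ in $G$. $\operatorname{Rist}_G(v)$ is the subgroup of elements of $G$ acting trivially outside $T_v$, and $\operatorname{Rist}_G(\mathcal L_n)$ is the subgroup generated by all $\operatorname{Rist}_G(v)$, $v\in\mathcal L_n$. $G$ is branch if it acts transitively on every $\mathcal L_n$, all $\operatorname{Rist}_G(v)$ are infinite,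 and every $\operatorname{Rist}_G(\mathcal L_n)$ has finite index in $G$. $G$ is self-replicating if $\varphi_v(\operatorname{Stab}_G(v))=G$ for all vertices $v$. A transversal of $T$ is a set $X$ of vertices such that every infinite ray starting at the root passes through exactly one element of $X$ (such an $X$ is finite). $G$ has the weak subgroup induction property if for every finitely generated subgroup $H\leq G$ there is a transversal $X$ of $T$ such that for each $v\in X$ the group $\varphi_v(\operatorname{Stab}_H(X))$ is either trivial or of finite index in $\varphi_v(\operatorname{Stab}_G(v))$. *)

(* Defs.v *)
From HB Require Import structures.
From mathcomp Require Import all_boot.
From mathcomp Require Import boolp classical_sets functions cardinality.

Set Implicit Arguments.
Unset Strict Implicit.
Unset Printing Implicit Defensive.

Local Open Scope classical_set_scope.
Local Open Scope group_scope.

(* Subgroups of a possibly infinite group gT are sets in gT satisfying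
   subgroup. *)

Definition subgroup (gT : groupType) (A : set gT) : Prop :=
  group_closed [in A].

Definition generated (gT : groupType) (A : set gT) : set gT :=
  smallest (@subgroup gT) A.

Definition finitely_generated (gT : groupType) (A : set gT) : Prop :=
  exists2 S : set gT, finite_set S & A = generated S.

Definition finite_index (gT : groupType) (B A : set gT) : Prop :=
  B `<=` A /\ finite_set [set [set g * b | b in B] | g in A].

Definition isomorphic (gT1 gT2 : groupType) (A : set gT1) (B : set gT2) :
    Prop :=
  exists2 f : gT1 -> gT2, {in A &, {morph f : x y / x * y}} & set_bij A B f.

Definition commensurable (gT1 gT2 : groupType) (A : set gT1) (B : set gT2) :
    Prop :=
  exists (A0 : set gT1) (B0 : set gT2),
    [/\ subgroup A0, finite_index A0 A, subgroup B0, finite_index B0 B &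
        isomorphic A0 B0].

Definition direct_power (gT : groupType) (A : set gT) (k : nat) :
    set {ffun 'I_k -> gT} :=
  [set f | forall i, A (f i)].
Arguments direct_power {gT} A k.

(* The d-regular rooted tree: vertices are words over 'I_d, and the children
   of v are the rcons v i. *)

Definition vertex (d : nat) := seq 'I_d.

Definition adjacent (d : nat) (u v : vertex d) : Prop :=
  exists i, v = rcons u i \/ u = rcons v i.

Definition is_tree_aut (d : nat) (f : vertex d -> vertex d) : Prop :=
  [/\ bijective f, f [::] = [::] &
      forall u v, adjacent (f u) (f v) <-> adjacent u v].

Record tree_aut (d : nat) := TreeAut {
  tree_fun :> vertex d -> vertex d;
  tree_autP : is_tree_aut tree_fun }.

HB.instance Definition _ (d : nat) := gen_eqMixin (tree_aut d).
HB.instance Definition _ (d : nat) := gen_choiceMixin (tree_aut d).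

Section TreeAutGroup.
Variable d : nat.
Implicit Types (f g h : tree_aut d) (u v w : vertex d).

Lemma tree_aut_eq g h : g =1 h -> g = h.
Proof.
case: g h => [g gP] [h hP] /= /funext gh; case: h / gh hP => hP.
by congr TreeAut; exact: Prop_irrelevance.
Qed.

Lemma tree_one_subproof : is_tree_aut (@id (vertex d)).
Proof. by split => //; exists id. Qed.

Definition tree_one := TreeAut tree_one_subproof.

Lemma tree_mul_subproof g h : is_tree_aut (g \o h).
Proof.
case: (tree_autP g) => gb g0 ga; case: (tree_autP h) => hb h0 ha.
split; first exact: bij_comp; first by rewrite /= h0 g0.
by move=> u v /=; rewrite ga ha.
Qed.

Definition tree_mul g h := TreeAut (tree_mul_subproof g h).

Lemma tree_inv_subproof g :
  {k : vertex d -> vertex d | [/\ is_tree_aut k, cancel g k & cancel k g]}.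
Proof.
apply: cid; case: (tree_autP g) => -[k gk kg] g0 ga; exists k; split=> //.
split; first by exists g.
  by rewrite -[in LHS]g0 gk.
by move=> u v; rewrite -ga !kg.
Qed.

Definition tree_inv g :=
  let: exist k kP := tree_inv_subproof g in TreeAut (let: And3 p _ _ := kP in p).

Lemma tree_invK g : cancel g (tree_inv g).
Proof. by rewrite /tree_inv; case: tree_inv_subproof => k [? ? ?]. Qed.

Lemma tree_invKV g : cancel (tree_inv g) g.
Proof. by rewrite /tree_inv; case: tree_inv_subproof => k [? ? ?]. Qed.

Lemma tree_mulA : associative tree_mul.
Proof. by move=> f g h; exact: tree_aut_eq. Qed.

Lemma tree_mul1 : left_id tree_one tree_mul.
Proof. by move=> g; exact: tree_aut_eq. Qed.

Lemma tree_mulr1 : right_id tree_one tree_mul.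
Proof. by move=> g; exact: tree_aut_eq. Qed.

Lemma tree_mulV : left_inverse tree_one tree_inv tree_mul.
Proof. by move=> g; apply: tree_aut_eq => v /=; rewrite tree_invK. Qed.

Lemma tree_mulrV : right_inverse tree_one tree_inv tree_mul.
Proof. by move=> g; apply: tree_aut_eq => v /=; rewrite tree_invKV. Qed.

HB.instance Definition _ := isGroup.Build (tree_aut d)
  tree_mulA tree_mul1 tree_mulr1 tree_mulV tree_mulrV.

Lemma tree_aut1 v : (1 : tree_aut d) v = v. Proof. by []. Qed.

Lemma tree_autM g h v : (g * h) v = g (h v). Proof. by []. Qed.

Lemma tree_aut_inj g : injective g.
Proof. by case: (tree_autP g) => /bij_inj. Qed.

(* The level-preservation argument: the image of a child of v is adjacent to
   g v, and it cannot be the parent of g v, which is the image of the parent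
   of v. *)
Lemma tree_aut_rcons g v i : exists j, g (rcons v i) = rcons (g v) j.
Proof.
have adjg u j : adjacent (g u) (g (rcons u j)).
  by case: (tree_autP g) => _ _ ->; exists j; left.
elim/last_ind: v i => [|v k IHv] i.
  have [j [->|]] := adjg [::] i; first by exists j.
  case: (tree_autP g) => _ -> _ /(congr1 size).
  by rewrite size_rcons.
have [j [->|gE]] := adjg (rcons v k) i; first by exists j.
have [l gE'] := IHv k.
move: gE; rewrite gE' => /rcons_inj[/tree_aut_inj /(congr1 size)].
by rewrite !size_rcons => /eqP; rewrite -addn2 -{1}[size v]addn0 eqn_add2l.
Qed.

Lemma size_tree_aut g v : size (g v) = size v.
Proof.
elim/last_ind: v => [|v i IHv]; first by case: (tree_autP g) => _ ->.
by have [j ->] := tree_aut_rcons g v i; rewrite !size_rcons IHv.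
Qed.

Definition section_fun v g w := drop (size v) (g (v ++ w)).

Lemma section_funP v g w : g (v ++ w) = g v ++ section_fun v g w.
Proof.
rewrite /section_fun; elim/last_ind: w => [|w i IHw].
  by rewrite cats0 -(size_tree_aut g) drop_size cats0.
rewrite -rcons_cat; have [j ->] := tree_aut_rcons g (v ++ w) i.
rewrite drop_rcons -?rcons_cat -?IHw //.
by rewrite size_tree_aut size_cat leq_addr.
Qed.

Lemma section_funK v g : cancel (section_fun v g) (section_fun (g v) g^-1).
Proof.
move=> w; rewrite {1}/section_fun -section_funP size_tree_aut.
by rewrite [g^-1 _](tree_invK g) drop_size_cat.
Qed.

Lemma adjacent_cat u v w : adjacent (u ++ v) (u ++ w) <-> adjacent v w.
Proof.
split=> -[i] H; exists i; move: H; rewrite !rcons_cat.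
  by case=> /eqP; rewrite eqseq_cat // eqxx /= => /eqP; [left|right].
by case=> ->; [left|right].
Qed.

Lemma tree_section_subproof v g : is_tree_aut (section_fun v g).
Proof.
split.
- exists (section_fun (g v) g^-1); first exact: section_funK.
  have := @section_funK (g v) g^-1.
  by rewrite [g^-1 (g v)](tree_invK g) invgK.
- by rewrite /section_fun cats0 -(size_tree_aut g) drop_size.
move=> u w; rewrite -(adjacent_cat (g v)) -!section_funP.
by case: (tree_autP g) => _ _ ->; exact: adjacent_cat.
Qed.

Definition tree_section v g : tree_aut d :=
  TreeAut (tree_section_subproof v g).

Lemma tree_sectionP v g w : g (v ++ w) = g v ++ tree_section v g w.
Proof. exact: section_funP. Qed.

Lemma tree_section_uniq v g h :
  (forall w, g (v ++ w) = g v ++ h w) -> h = tree_section v g.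
Proof.
move=> hP; apply: tree_aut_eq => w; apply/eqP.
by have /eqP := hP w; rewrite tree_sectionP eqseq_cat // eqxx eq_sym.
Qed.

End TreeAutGroup.

Section BranchGroups.
Variable d : nat.
Implicit Types (G H : set (tree_aut d)) (v : vertex d) (X : set (vertex d)).

Definition level (n : nat) : set (vertex d) := [set v | size v = n].

Definition stab G X : set (tree_aut d) :=
  [set g | G g /\ forall v, X v -> g v = v].

Definition rist G v : set (tree_aut d) :=
  [set g | G g /\ forall u, ~~ prefix v u -> g u = u].

Definition rist_level G (n : nat) : set (tree_aut d) :=
  generated (\bigcup_(v in level n) rist G v).

Definition branch G : Prop :=
  [/\ forall n u v, level n u -> level n v -> exists2 g, G g & g u = v,
      forall v, infinite_set (rist G v) &
      forall n, finite_index (rist_level G n) G].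

Definition self_replicating G : Prop :=
  forall v, tree_section v @` stab G [set v] = G.

Definition ray (r : nat -> vertex d) : Prop :=
  r 0%N = [::] /\ forall n, exists i, r n.+1 = rcons (r n) i.

Definition transversal X : Prop :=
  forall r, ray r -> exists! v, (X `&` range r) v.

Definition weak_subgroup_induction G : Prop :=
  forall H, subgroup H -> H `<=` G -> finitely_generated H ->
  exists2 X, transversal X &
    forall v, X v ->
      tree_section v @` stab H X = [set 1] \/
      finite_index (tree_section v @` stab H X)
                   (tree_section v @` stab G [set v]).

End BranchGroups.

(* Main.v *)
Require Import Defs.
From mathcomp Require Import all_boot.
From mathcomp Require Import boolp classical_sets functions cardinality.

(** Write phi_v for the section at v.  The weak subgroup induction property and
    self-replication provide a level n such that the subgroup K of H fixing that
    level pointwise, which has finite index in H, has each section group phi_v(K),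
    v of length n, trivial or of finite index in G (sections_dichotomy).  So K
    is, up to the trivial factors, a subdirect product of finite-index subgroups
    of G, and the point is to recognize such a product as a virtual power of G.

    Two facts about G make this possible.  First, G is torsion: for a cyclic H the
    second alternative never holds, since a virtually cyclic G could not contain
    the commuting infinite groups Rist(0) and Rist(1), which meet trivially.  As G
    is also finitely generated, a subgroup of G that contains all commutators of a finite-index
    subgroup has finite index (virt_sub_derived).  Secondly, a finite-index
    subgroup of a group acting transitively on all levels is transitive below
    each vertex of some level (virt_sub_eventually_transitive), because its
    number of orbits on a level is bounded.

    Work at such a level and choose a minimal list s of vertices for which K acts
    faithfully on the union of the subtrees at the K-orbits of s.  By minimality,
    each w in s has an element of K that acts trivially at the orbits of the
    other members of s but not at the orbit of w, and by transitivity its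
    conjugates move every sufficiently deep vertex u below that orbit.  If g is
    such a conjugate and a, b in K have at the level-n ancestor of u sections
    supported below u, then a double commutator of g, a and b acts as
    [phi_u(a), phi_u(b)] below u and trivially at all other vertices of the same
    kind (commutator_isolates).  Hence the elements of K acting only below u, among
    the vertices of this finite set S, have a section group at u of finite index in
    G.  Taking sections at S thus identifies a finite-index subgroup of K with a
    finite-index subgroup of the |S|-th power of G (commensurable_direct_power).

    Finally, the stabilizer of the first level embeds in G^d as a subgroup of
    finite index, so G^(k+1) and G^(k+d) are commensurable, and a positive exponent
    can be lowered by d - 1 until it is at most d - 1. *)

Set Implicit Arguments.
Unset Strict Implicit.
Unset Printing Implicit Defensive.

Local Open Scope classical_set_scope.
Local Open Scope group_scope.

(** * Subgroups of finite index and finitely generated torsion groups *)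

Section Subgroups.
Variable gT : groupType.
Implicit Types (A B C D M : set gT) (g h x y : gT).

Lemma subgroupP A : subgroup A <-> A 1 /\ forall x y, A x -> A y -> A (x * y^-1).
Proof.
split=> -[A1 Ad]; split.
- by move: A1; rewrite inE.
- by move=> x y Ax Ay; have := Ad x y; rewrite !inE; apply.
- by rewrite inE.
- by move=> x y; rewrite !inE; exact: Ad.
Qed.

Lemma subgroup1 A : subgroup A -> A 1.
Proof. by case/subgroupP. Qed.

Lemma subgroupV A x : subgroup A -> A x -> A x^-1.
Proof. by case/subgroupP=> A1 Ad Ax; rewrite -[_^-1]mul1g; exact: Ad. Qed.

Lemma subgroupM A x y : subgroup A -> A x -> A y -> A (x * y).
Proof.
move=> sA Ax Ay; case/subgroupP: (sA) => _ Ad.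
by rewrite -[y]invgK; apply: Ad => //; exact: subgroupV.
Qed.

Lemma subgroupVM A x y : subgroup A -> A x -> A y -> A (x^-1 * y).
Proof. by move=> sA Ax Ay; apply: subgroupM => //; exact: subgroupV. Qed.

Lemma subgroupX A x n : subgroup A -> A x -> A (x ^+ n).
Proof.
move=> sA Ax; elim: n => [|n IHn]; first exact: subgroup1.
by rewrite expgS; exact: subgroupM.
Qed.

Lemma subgroupI A B : subgroup A -> subgroup B -> subgroup (A `&` B).
Proof.
move=> sA sB; apply/subgroupP; split; first by split; exact: subgroup1.
by move=> x y [Ax Bx] [Ay By]; split; apply: subgroupM => //; exact: subgroupV.
Qed.

Lemma subgroup_generated A : subgroup (generated A).
Proof.
apply/subgroupP; split; first by move=> B [/subgroup1].
by move=> x y Ax Ay B BA; case/subgroupP: (BA.1) => _; apply; [exact: Ax|exact: Ay].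
Qed.

Lemma generated_gen A : A `<=` generated A.
Proof. exact: sub_gen_smallest. Qed.

Lemma generated_sub A B : subgroup B -> A `<=` B -> generated A `<=` B.
Proof. exact: smallest_sub. Qed.

(** For subgroups, this says that A `&` B has finite index in A.  A finite
    colouring whose colour classes lie in single cosets of B can be composed,
    restricted, pulled back and multiplied without choosing representatives. *)
Definition virt_sub A B : Prop :=
  exists (T : finType) (c : gT -> T),
    forall g h, A g -> A h -> c g = c h -> B (g^-1 * h).

Lemma sub_virt_sub A B : subgroup B -> A `<=` B -> virt_sub A B.
Proof.
move=> sB AB; exists unit, (fun=> tt) => g h Ag Ah _.
by apply: subgroupVM => //; exact: AB.
Qed.

Lemma virt_subS A A' B B' :
  A' `<=` A -> B `<=` B' -> virt_sub A B -> virt_sub A' B'.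
Proof.
move=> AA BB [T [c cP]]; exists T, c => g h Ag Ah gh.
by apply: BB; apply: cP => //; exact: AA.
Qed.

Lemma virt_subI A B C :
  subgroup C -> A `<=` C -> virt_sub A B -> virt_sub A (B `&` C).
Proof.
move=> sC AC [T [c cP]]; exists T, c => g h Ag Ah gh.
by split; [exact: cP|apply: subgroupVM => //; exact: AC].
Qed.

Lemma coloring_rep A (T : finType) (c : gT -> T) :
  exists r : T -> gT, forall g, A g -> A (r (c g)) /\ c (r (c g)) = c g.
Proof.
exists (fun t => xget 1 [set g | A g /\ c g = t]) => g Ag.
by case: xgetP => [x -> //|/(_ g)]; case.
Qed.

(** A colour class of A with representative r lies in r B, so its translate by
    r^-1 is in B, where the second colouring refines it. *)
Lemma virt_sub_trans A B C : virt_sub A B -> virt_sub B C -> virt_sub A C.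
Proof.
move=> [T [c cP]] [T' [c' cP']]; have [r rP] := coloring_rep A c.
exists (T * T')%type, (fun g => (c g, c' ((r (c g))^-1 * g))).
move=> g h Ag Ah [cgh c'gh]; have [Ar cr] := rP _ Ag.
have -> : g^-1 * h = ((r (c g))^-1 * g)^-1 * ((r (c g))^-1 * h).
  by rewrite invgM invgK -mulgA mulVKg.
by apply: cP'; [exact: cP| apply: cP => //; rewrite cr | rewrite {2}cgh].
Qed.

(** Two powers of g have the same colour; their quotient is a power of g in B. *)
Lemma virt_sub_expg A B g : subgroup A -> virt_sub A B -> A g ->
  exists2 n, (0 < n)%N & B (g ^+ n).
Proof.
move=> sA [T [c cP]] Ag.
have /injectivePn[i [j ij cij]] :
    ~~ injectiveb (fun i : 'I_#|T|.+1 => c (g ^+ i)).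
  apply/injectiveP => /leq_card; rewrite card_ord ltnn => //.
wlog lt_ij : i j ij cij / (i < j)%N.
  move=> Hw; have [lt|le] := ltnP i j; first exact: (Hw i j).
  apply: (Hw j i) => //; first by rewrite eq_sym.
  by rewrite ltn_neqAle le andbT eq_sym.
exists (j - i)%N; first by rewrite subn_gt0.
have -> : g ^+ (j - i) = (g ^+ i)^-1 * g ^+ j.
  by rewrite -[in RHS](subnKC (ltnW lt_ij)) expgnDr mulKg.
by apply: cP => //; exact: subgroupX.
Qed.

Lemma finite_index_virt_sub A B :
  subgroup B -> (finite_index B A <-> B `<=` A /\ virt_sub A B).
Proof.
move=> sB; pose cos g := [set g * b | b in B].
split=> -[BA fin]; split=> //.
   have [n /card_set_bijP[f [f1 f2 _]]] := (finite_setP _).1 fin.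
  have lt g : A g -> (f (cos g) < n)%N.
    by move=> Ag; have := f1 (cos g) (ex_intro2 _ _ g Ag erefl).
  exists 'I_n.+1, (fun g => inord (f (cos g))) => g h Ag Ah.
  move=> /(congr1 (@nat_of_ord n.+1)).
  rewrite !inordK ?ltnS; try by apply: ltnW; exact: lt.
  have: (cos g) \in [set [set g0 * b | b in B] | g0 in A] by rewrite inE; exists g.
  have: (cos h) \in [set [set g0 * b | b in B] | g0 in A] by rewrite inE; exists h.
  move=> ch cg /(f2 _ _ cg ch) E.
  have: cos h h by exists 1; [exact: subgroup1|rewrite mulg1].
  by rewrite -E => -[b Bb <-]; rewrite mulKg.
case: fin => T [c cP]; have [r rP] := coloring_rep A c.
apply: sub_finite_set (finite_image (fun t => cos (r t)) (@finite_finset T setT)).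
move=> _ [g Ag <-]; exists (c g) => //; have [Ar cr] := rP _ Ag.
have Br := cP _ _ Ar Ag cr.
apply/seteqP; split=> _ [b Bb <-].
  exists ((g^-1 * r (c g)) * b); last by rewrite -mulgA mulVKg.
  by apply: subgroupM => //; rewrite -[g^-1 * _]invgK invgM invgK; exact: subgroupV.
exists ((r (c g))^-1 * g * b).
  exact: subgroupM.
by rewrite -mulgA mulVKg.
Qed.

End Subgroups.

Lemma virt_sub_image (gT rT : groupType) (f : gT -> rT) (A B : set gT) :
    subgroup A -> (forall x y, A x -> A y -> f (x * y) = f x * f y) ->
  virt_sub A B -> virt_sub (f @` A) (f @` (B `&` A)).
Proof.
move=> sA fM [T [c cP]].
pose r y := xget 1 [set x | A x /\ f x = y].
have rP y : (f @` A) y -> A (r y) /\ f (r y) = y.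
  by case=> x Ax fx; rewrite /r; case: xgetP => [z -> //|/(_ x)]; case.
exists T, (c \o r) => g h /rP[Ag fg] /rP[Ah fh] /= cgh.
exists ((r g)^-1 * r h).
  by split; [exact: cP|exact: subgroupVM].
have hE : f (r g * ((r g)^-1 * r h)) = h by rewrite mulVKg.
by rewrite -[in RHS]hE (fM (r g)) ?fg ?mulKg //; exact: subgroupVM.
Qed.

Lemma virt_sub_preimage (gT rT : groupType) (f : gT -> rT) (A : set gT)
    (B C : set rT) :
    subgroup A -> (forall x y, A x -> A y -> f (x * y) = f x * f y) ->
    (forall x, A x -> C (f x)) ->
  virt_sub C B -> virt_sub A (f @^-1` B).
Proof.
move=> sA fM fC [T [c cP]]; exists T, (c \o f) => g h Ag Ah /= cgh.
have -> : f (g^-1 * h) = (f g)^-1 * f h.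
  by rewrite -{2}[h](mulVKg g) (fM g) ?mulKg //; exact: subgroupVM.
by apply: cP => //; exact: fC.
Qed.

Lemma virt_sub_power (gT : groupType) (G : set gT) k (D : 'I_k -> set gT) :
    (forall i, virt_sub G (D i)) ->
  virt_sub (direct_power G k) [set f | forall i, D i (f i)].
Proof.
move=> GD; have /choice[T cP] : forall i, exists T : finType, exists c : gT -> T,
  forall g h, G g -> G h -> c g = c h -> D i (g^-1 * h) by [].
pose c i := projT1 (cid (cP i)).
exists {dffun forall i, T i}, (fun f : {ffun 'I_k -> gT} => [ffun i => c i (f i)]).
move=> g h Gg Gh /ffunP cgh i; rewrite !ffunE.
apply: (projT2 (cid (cP i))) => //.
by have := cgh i; rewrite !ffunE.
Qed.


Section FinitelyGenerated.
Variable gT : groupType.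
Implicit Types (A B C D G M : set gT) (g h x y : gT).

Lemma generated_seq A : finitely_generated A ->
  exists s : seq gT, A = generated [set` s].
Proof. by case=> S /finite_seqP[s ->] ->; exists s. Qed.

(** Schreier's lemma.  With representatives p t of the right cosets of M, the
    elements p t * s * p t'^-1 of M, for s or s^-1 a generator of G, together with
    the p t that lie in M, generate M: the products m * p t with m generated by
    them are stable under right multiplication by the generators of G. *)
Lemma finitely_generated_virt G M :
    subgroup G -> finitely_generated G -> subgroup M -> M `<=` G ->
  virt_sub G M -> finitely_generated M.
Proof.
move=> sG [S finS GE] sM MG [T [c cP]].
have SG : S `<=` G by rewrite GE; exact: generated_gen.
have [r rP] := coloring_rep G c.
(* Inverses turn the colouring by left cosets into one by right cosets. *)
pose p t := (r t)^-1.
have pP g : G g -> [/\ G (p (c g^-1)) & M (g * (p (c g^-1))^-1)].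
  move=> Gg; have [Gr cr] := rP _ (subgroupV sG Gg).
  split; first exact: subgroupV.
  by rewrite invgK -{1}[g]invgK; apply: cP => //; exact: subgroupV.
pose e (b : bool) (s : gT) := if b then s^-1 else s.
pose schreier := [set x | exists t, M x /\ (x = p t \/
   exists b s, S s /\ x = p t * e b s * (p (c (p t * e b s)^-1))^-1)].
pose M0 := generated schreier.
have sM0 : subgroup M0 := subgroup_generated _.
have M0M : M0 `<=` M by apply: generated_sub => // x [t []].
pose Q := [set g | exists t, [/\ G (p t) , M0 (g * (p t)^-1) & G g]].
have Qe b s g : S s -> Q g -> Q (g * e b s).
  move=> Ss [t [Gp Mg Gg]].
  have Ges : G (e b s) by case: b => /=; [apply: subgroupV => //|]; exact: SG.
  have Gpes := subgroupM sG Gp Ges.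
  have [Gp' Mp'] := pP _ Gpes.
  exists (c (p t * e b s)^-1); split=> //; last exact: subgroupM.
  rewrite -(mulgVK (p t) g) -2!mulgA; apply: (subgroupM sM0) => //.
  by apply: generated_gen; rewrite mulgA; exists t; split=> //; right; exists b, s.
have Q1 : Q 1.
  have [Gp Mp] := pP _ (subgroup1 sG).
  exists (c 1^-1); split=> //; last exact: subgroup1.
  rewrite mul1g; apply: (subgroupV sM0).
  apply: generated_gen; exists (c 1^-1); split; last by left.
  by rewrite -[p _]invgK; apply: subgroupV; rewrite // -[_^-1]mul1g.
have GQ : G `<=` Q.
  pose P := [set h | forall g, (Q g -> Q (g * h)) /\ (Q g -> Q (g * h^-1))].
  suff : G `<=` P by move=> GP g /GP/(_ 1)[/(_ Q1)]; rewrite mul1g.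
  rewrite {1}GE; apply: generated_sub.
    apply/subgroupP; split; first by move=> g; rewrite invg1 mulg1.
    move=> x y Px Py g; rewrite !mulgA invgM invgK mulgA.
    split=> Qg; first by apply: (Py _).2; apply: (Px _).1.
    by apply: (Px _).2; apply: (Py _).1.
  by move=> s Ss g; split=> Qg; [apply: (Qe false s)|apply: (Qe true s)].
exists schreier.
  pose F t := p t; pose F' t b s := p t * e b s * (p (c (p t * e b s)^-1))^-1.
  have sub : schreier `<=` (F @` setT) `|`
     [set F' x.1.1 x.1.2 x.2 | x in [set: T * bool] `*` S].
    move=> x [t [_ [->|[b [s [Ss ->]]]]]]; [left|right]; first by exists t.
    by exists ((t, b), s).
  apply: (sub_finite_set sub).
  rewrite finite_setU; split; apply: finite_image; first exact: finite_finset.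
  by apply: finite_setX => //; exact: finite_finset.
apply/seteqP; split=> // g Mg; have [t [Gp Mp _]] := GQ _ (MG _ Mg).
rewrite -(mulgVK (p t) g); apply: (subgroupM sM0) => //; apply: generated_gen.
exists t; split; last by left.
rewrite -[p t]invgK; apply: subgroupV => //.
by rewrite -[_^-1](mulKg g); apply: subgroupVM => //; exact: M0M.
Qed.

Definition torsion A := forall g, A g -> exists2 n, (0 < n)%N & g ^+ n = 1.

(** E is normal in M since it contains the commutators of M, so the powers of t
    times E form a group, in which the index of E is at most the order of t. *)
Lemma virt_sub_adjoin M E t :
    subgroup M -> subgroup E -> E `<=` M ->
    (forall x y, M x -> M y -> E [~ x, y]) ->
    M t -> (exists2 n, (0 < n)%N & t ^+ n = 1) ->
  exists E', [/\ subgroup E', E' `<=` M, E `<=` E', E' t & virt_sub E' E].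
Proof.
move=> sM sE EM EC Mt [n n0 tn].
have EJ x y : E x -> M y -> E (x ^ y).
  by move=> Ex My; rewrite -[x ^ y](mulVKg x) -commgEl; apply: subgroupM => //;
     apply: EC => //; exact: EM.
have tV e : t ^- e = t ^+ (e * n.-1).
  apply: (@mulgI _ (t ^+ e)); rewrite mulgV -expgnDr -mulnS prednK //.
  by rewrite mulnC expgnA tn expg1n.
exists [set g | exists e, E (t ^- e * g)]; split.
- apply/subgroupP; split; first by exists 0; rewrite expg0 invg1 mulg1; exact: subgroup1.
  move=> x y [e Ex] [f Ey]; exists (e + f * n.-1)%N.
  rewrite expgnDr -tV invgM invgK.
  have -> : t ^+ f * t ^- e * (x * y^-1) =
     (t ^- e * x * (t ^- f * y)^-1) ^ (t ^- f).
    by rewrite /conjg !invgM !invgK !mulgA mulgK.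
  apply: EJ; last by apply: subgroupV => //; exact: subgroupX.
  by apply: subgroupM => //; exact: subgroupV.
- move=> x [e /EM Mx]; rewrite -(mulVKg (t ^+ e) x); apply: subgroupM => //.
  exact: subgroupX.
- by move=> x Ex; exists 0; rewrite expg0 invg1 mul1g.
- by exists 1%N; rewrite expg1 mulVg; exact: subgroup1.
pose ex g := xget 0 [set e | E (t ^- e * g)].
exists 'I_n, (fun g => Ordinal (ltn_pmod (ex g) n0)).
have texmod e : t ^+ (e %% n) = t ^+ e.
  by rewrite {2}(divn_eq e n) expgnDr mulnC expgnA tn expg1n mul1g.
move=> g h [e1 Eg] [e2 Eh] /(congr1 (@nat_of_ord _)) /= exgh.
have {Eg} : E (t ^- ex g * g) by rewrite /ex; case: xgetP => [z -> //|/(_ e1)].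
have {Eh} : E (t ^- ex h * h) by rewrite /ex; case: xgetP => [z -> //|/(_ e2)].
rewrite -texmod -exgh texmod => Eh Eg.
by have := subgroupVM sE Eg Eh; rewrite invgM invgK -mulgA mulVKg.
Qed.

(** M is finitely generated and torsion, so its abelianization is finite, and D
    contains the derived subgroup of M.  The generators of M are adjoined to
    D `&` M one at a time. *)
Lemma virt_sub_derived G M D :
    subgroup G -> finitely_generated G -> torsion G ->
    subgroup M -> M `<=` G -> virt_sub G M ->
    subgroup D -> (forall x y, M x -> M y -> D [~ x, y]) ->
  virt_sub G D.
Proof.
move=> sG fG tG sM MG GM sD DC; apply: virt_sub_trans (GM) _.
have [s ME] := generated_seq (finitely_generated_virt sG fG sM MG GM).
have sMs x : x \in s -> M x by move=> xs; rewrite ME; exact: generated_gen.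
suff [E [sE _ _ sEs]] : exists E, [/\ subgroup E, E `<=` M, D `&` M `<=` E,
    (forall x, x \in s -> E x) & virt_sub E (D `&` M)].
  apply: virt_subS; last exact: subIsetl.
  by rewrite ME; apply: generated_sub.
have MC x y : M x -> M y -> M [~ x, y].
  move=> Mx My; rewrite /commg /conjg.
  by do !apply: subgroupM => //; exact: subgroupV.
elim: s {ME} sMs => [|t s IHs] sMs.
  exists (D `&` M); split=> //; try exact: subIsetr; first exact: subgroupI.
  by apply: sub_virt_sub => //; exact: subgroupI.
have [|E [sE EM DE sEs EV]] := IHs.
  by move=> x xs; apply: sMs; rewrite inE xs orbT.
have Mt : M t by apply: sMs; rewrite inE eqxx.
have [||E' [sE' E'M EE' E't E'V]] := @virt_sub_adjoin M E t sM sE EM _ Mt _.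
- by move=> x y Mx My; apply: DE; split; [exact: DC|exact: MC].
- exact/tG/MG.
exists E'; split=> //; first exact: subset_trans DE EE'.
  by move=> x; rewrite inE => /orP[/eqP->//|/sEs/EE'].
exact: virt_sub_trans E'V EV.
Qed.

End FinitelyGenerated.

Lemma finite_virt_sub1 (gT : groupType) (A B : set gT) :
  virt_sub A B -> B `<=` [set 1] -> finite_set A.
Proof.
move=> [T [c cP]] B1; have [r rP] := coloring_rep A c.
apply: (@sub_finite_set _ _ (r @` setT)); last exact/finite_image/finite_finset.
move=> g Ag; exists (c g) => //; have [Ar cr] := rP _ Ag.
have /B1/= : B ((r (c g))^-1 * g) by exact: cP.
by move/(congr1 (fun x => r (c g) * x)); rewrite mulVKg mulg1.
Qed.

Lemma generated1P (gT : groupType) (g x : gT) :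
  generated [set g] x -> exists k, x = g ^+ k \/ x^-1 = g ^+ k.
Proof.
apply: (@generated_sub _ _ [set x | exists k, x = g ^+ k \/ x^-1 = g ^+ k]); last first.
  by move=> _ ->; exists 1%N; left; rewrite expg1.
have subX m n : exists k, g ^+ m * g ^- n = g ^+ k \/ (g ^+ m * g ^- n)^-1 = g ^+ k.
  have [le|/ltnW le] := leqP n m; first by exists (m - n)%N; left; rewrite expgnFr.
  by exists (n - m)%N; right; rewrite invgF expgnFr.
apply/subgroupP; split; first by exists 0; left.
move=> {}x y [m xE] [n yE].
case: xE => xE; case: yE => yE.
- by rewrite xE yE.
- rewrite yE xE -expgnDr; exists (m + n)%N; by left.
- by exists (n + m)%N; right; rewrite invgF xE yE expgnDr.
- rewrite yE -[x]invgK xE; have [k kP] := subX n m; exists k.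
  have <- : g ^+ n * g ^- m = g ^- m * g ^+ n.
    by apply: commuteV; exact: commuteX2.
  by [].
Qed.

(** * Commensurability and direct powers *)

Section MorphismsOnSubgroups.
Variables (gT rT : groupType) (f : gT -> rT) (A : set gT).
Hypothesis sA : subgroup A.
Hypothesis fM : forall x y, A x -> A y -> f (x * y) = f x * f y.

Lemma morph_on1 : f 1 = 1.
Proof.
apply: (@mulgI _ (f 1)); rewrite -fM ?mulg1 //; exact: subgroup1.
Qed.

Lemma morph_onV x : A x -> f x^-1 = (f x)^-1.
Proof.
move=> Ax; apply: (@mulgI _ (f x)).
by rewrite -fM ?mulgV ?morph_on1 //; exact: subgroupV.
Qed.

Lemma subgroup_image : subgroup (f @` A).
Proof.
apply/subgroupP; split; first by exists 1; [exact: subgroup1|exact: morph_on1].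
move=> _ _ [x Ax <-] [y Ay <-]; exists (x * y^-1).
  by apply: subgroupM => //; exact: subgroupV.
by rewrite fM ?morph_onV //; exact: subgroupV.
Qed.

Lemma subgroup_preimage (B : set rT) : subgroup B -> subgroup (f @^-1` B `&` A).
Proof.
move=> sB; apply/subgroupP; split.
  by split; [rewrite /preimage /= morph_on1; exact: subgroup1|exact: subgroup1].
move=> x y [Bx Ax] [By Ay]; split; last by apply: subgroupM => //; exact: subgroupV.
rewrite /preimage /= fM ?morph_onV //; last exact: subgroupV.
by apply: subgroupM => //; exact: subgroupV.
Qed.

Lemma morph_on_inj : (forall x, A x -> f x = 1 -> x = 1) -> {in A &, injective f}.
Proof.
move=> f1 x y; rewrite !inE => Ax Ay fxy.
rewrite -[x](mulgVK y) (f1 (x * y^-1)) ?mul1g //.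
  by apply: subgroupM => //; exact: subgroupV.
by rewrite fM ?morph_onV ?fxy ?mulgV //; exact: subgroupV.
Qed.

End MorphismsOnSubgroups.

(** Symmetry and transitivity of commensurability in one statement: the two
    finite-index subgroups of B are intersected, and the intersection is pulled
    back to A and to C. *)
Lemma commensurable_joint (gT1 gT2 gT3 : groupType)
    (A : set gT1) (B : set gT2) (C : set gT3) :
  commensurable A B -> commensurable C B -> commensurable A C.
Proof.
case=> A0 [B0 [sA0 iA0 sB0 iB0 [f fM [fB fI fS]]]].
case=> C0 [B1 [sC0 iC0 sB1 iB1 [g gM [gB gI gS]]]].
have [A0A vA0] := (finite_index_virt_sub A sA0).1 iA0.
have [B0B vB0] := (finite_index_virt_sub B sB0).1 iB0.
have [C0C vC0] := (finite_index_virt_sub C sC0).1 iC0.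
have [B1B vB1] := (finite_index_virt_sub B sB1).1 iB1.
have {}fM x y : A0 x -> A0 y -> f (x * y) = f x * f y by move=> ? ?; rewrite fM ?inE.
have {}gM x y : C0 x -> C0 y -> g (x * y) = g x * g y by move=> ? ?; rewrite gM ?inE.
have sA2 := subgroup_preimage sA0 fM sB1.
have sC2 := subgroup_preimage sC0 gM sB0.
pose h a := xget 1 [set c | C0 c /\ g c = f a].
have hP a : (f @^-1` B1 `&` A0) a -> C0 (h a) /\ g (h a) = f a.
  move=> [/gS[c Cc gc] Aa]; rewrite /h; case: xgetP => [x -> //|/(_ c)].
  by case.
exists (f @^-1` B1 `&` A0), (g @^-1` B0 `&` C0); split=> //.
- apply/finite_index_virt_sub => //; split; first by move=> x [_ /A0A].
  apply: virt_sub_trans vA0 _; apply: virt_subI => //.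
  by apply: virt_sub_preimage fB _ => //; exact: virt_subS B0B _ vB1.
- apply/finite_index_virt_sub => //; split; first by move=> x [_ /C0C].
  apply: virt_sub_trans vC0 _; apply: virt_subI => //.
  by apply: virt_sub_preimage gB _ => //; exact: virt_subS B1B _ vB0.
exists h.
  move=> x y; rewrite !inE => Ax Ay.
  have [Cx gx] := hP _ Ax; have [Cy gy] := hP _ Ay.
  have [Cxy gxy] := hP _ (subgroupM sA2 Ax Ay).
  apply: gI; rewrite ?inE //; first exact: subgroupM.
  by rewrite gM // gx gy gxy fM //; [exact: Ax.2|exact: Ay.2].
split.
- move=> a Aa; have [Ca ga] := hP _ Aa; split=> //.
  by rewrite /preimage /= ga; apply: fB; exact: Aa.2.
- move=> x y; rewrite !inE => Ax Ay hxy.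
  apply: fI; rewrite ?inE; [exact: Ax.2|exact: Ay.2|].
  by rewrite -(hP _ Ax).2 -(hP _ Ay).2 hxy.
move=> c [/fS[a Aa fa] Cc].
have Aa2 : (f @^-1` B1 `&` A0) a by split=> //; rewrite /preimage /= fa; exact: gB.
exists a => //; have [Ca ga] := hP _ Aa2.
by apply: gI; rewrite ?inE // ga.
Qed.

(** The joint map phi is injective on A1.  Its image contains the product over i
    of the images under phi i of the elements that every other phi j kills, which
    has finite index in the power of G as each factor has finite index in G. *)
Lemma commensurable_direct_power (gT hT : groupType) (A A1 : set gT)
    (G : set hT) (k : nat) (phi : 'I_k -> gT -> hT) :
    subgroup A1 -> A1 `<=` A -> virt_sub A A1 ->
    (forall i x y, A1 x -> A1 y -> phi i (x * y) = phi i x * phi i y) ->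
    (forall i x, A1 x -> G (phi i x)) ->
    (forall x, A1 x -> (forall i, phi i x = 1) -> x = 1) ->
    (forall i, virt_sub G
       [set y | exists x, [/\ A1 x, phi i x = y & forall j, j != i -> phi j x = 1]]) ->
  commensurable A (direct_power G k).
Proof.
move=> sA1 A1A vA phiM phiG phi1 phiD.
pose f x := [ffun i => phi i x].
have fM x y : A1 x -> A1 y -> f (x * y) = f x * f y.
  by move=> Ax Ay; apply/ffunP => i; rewrite !ffunE phiM.
have sf := subgroup_image sA1 fM.
exists A1, (f @` A1); split=> //; first exact/finite_index_virt_sub.
  apply/finite_index_virt_sub => //; split.
    by move=> _ [x Ax <-] i; rewrite ffunE; exact: phiG.
  apply: virt_subS (virt_sub_power phiD) => // y yD.
  have [xs xsP] := choice yD.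
  suff [x Ax xE] : exists2 x, A1 x &
      forall j, phi j x = if j \in enum 'I_k then y j else 1.
    by exists x => //; apply/ffunP => j; rewrite ffunE xE mem_enum.
  elim: (enum 'I_k) (enum_uniq 'I_k) => [_|i s IHs /= /andP[is_ /IHs[x Ax xE]]].
    by exists 1; [exact: subgroup1|move=> j; rewrite (morph_on1 sA1 (phiM j))].
  have [Axi xiE xi1] := xsP i.
  exists (xs i * x); first exact: subgroupM.
  move=> j; rewrite phiM // xE inE; case: (eqVneq j i) => [->|ji] /=.
    by rewrite xiE (negPf is_) mulg1.
  by rewrite xi1 // mul1g.
exists f; first by move=> x y; rewrite !inE; exact: fM.
split.
- by move=> x Ax; exists x.
- apply: (morph_on_inj sA1 fM) => x Ax fx1; apply: phi1 => // i.
  by have /ffunP/(_ i) := fx1; rewrite !ffunE.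
- by [].
Qed.

Lemma subgroup_direct_power (gT : groupType) (G : set gT) k :
  subgroup G -> subgroup (direct_power G k).
Proof.
move=> sG; apply/subgroupP; split; first by move=> i; rewrite ffunE; exact: subgroup1.
move=> x y Gx Gy i; rewrite !ffunE; apply: subgroupM => //.
exact: subgroupV.
Qed.

(** * Sections, stabilizers and transversals *)

Section Sections.
Variable d : nat.
Implicit Types (g h : tree_aut d) (u v w : vertex d).

Lemma tree_autK g v : g^-1 (g v) = v.
Proof. exact: tree_invK. Qed.

Lemma tree_autKV g v : g (g^-1 v) = v.
Proof. exact: tree_invKV. Qed.

Lemma tree_aut_fixV g v : g v = v -> g^-1 v = v.
Proof. by move=> gv; rewrite -[in LHS]gv tree_autK. Qed.

Lemma tree_aut_take g n v : g (take n v) = take n (g v).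
Proof.
have [vn|nv] := leqP (size v) n; first by rewrite !take_oversize ?size_tree_aut.
rewrite -[v in RHS](cat_take_drop n) tree_sectionP take_size_cat //.
by rewrite size_tree_aut size_take nv.
Qed.

Lemma tree_sectionM v g h :
  tree_section v (g * h) = tree_section (h v) g * tree_section v h.
Proof.
apply/esym/tree_section_uniq => w.
by rewrite !tree_autM !tree_sectionP.
Qed.

Lemma tree_section_id v : tree_section v 1 = 1.
Proof. by apply/esym/tree_section_uniq => w. Qed.

Lemma tree_section_cat u v g :
  tree_section (u ++ v) g = tree_section v (tree_section u g).
Proof.
apply/esym/tree_section_uniq => w.
by rewrite -!catA !tree_sectionP catA.
Qed.

Lemma tree_section_fix u v g : g (u ++ v) = u ++ v -> g u = u /\ tree_section u g v = v.
Proof.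
rewrite tree_sectionP => /eqP; rewrite eqseq_cat ?size_tree_aut //.
by case/andP=> /eqP-> /eqP->.
Qed.

Lemma tree_aut_eq1 n g :
  (forall v, size v = n -> g v = v /\ tree_section v g = 1) -> g = 1.
Proof.
move=> gP; apply: tree_aut_eq => v; rewrite tree_aut1.
have [nv|vn] := leqP n (size v).
  have [gt st] := gP (take n v) (size_takel nv).
  by rewrite -[v](cat_take_drop n) tree_sectionP gt st.
case: (posnP d) => [d0|d0].
  case: (v) => [|i v']; first by case: (tree_autP g).
  by case: i => i; have := leq0n i; rewrite leqNgt -d0 => /negP.
pose w := v ++ nseq (n - size v) (Ordinal d0).
have sw : size w = n by rewrite size_cat size_nseq subnKC // ltnW.
have [gw _] := gP _ sw.
by have [->] := tree_section_fix gw.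
Qed.

Lemma tree_section_fix_uniq u g h : (forall w, g (u ++ w) = u ++ h w) ->
  g u = u /\ tree_section u g = h.
Proof.
move=> gh; have gu : g u = u.
  have := gh [::]; rewrite cats0 => ->.
  by rewrite (size0nil (_ : size (h [::]) = 0)) ?size_tree_aut ?cats0.
by split=> //; apply/esym/tree_section_uniq => w; rewrite gh gu.
Qed.

Implicit Types (G H K L : set (tree_aut d)).

Lemma subgroup_stab G (X : set (vertex d)) : subgroup G -> subgroup (stab G X).
Proof.
move=> sG; apply/subgroupP; split; first by split; first exact: subgroup1.
move=> g h [Gg gX] [Gh hX]; split.
  by apply: subgroupM => //; exact: subgroupV.
by move=> v Xv; rewrite tree_autM tree_aut_fixV ?gX ?hX.
Qed.

Lemma subgroup_rist G v : subgroup G -> subgroup (rist G v).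
Proof.
move=> sG; apply/subgroupP; split; first by split; first exact: subgroup1.
move=> g h [Gg gX] [Gh hX]; split.
  by apply: subgroupM => //; exact: subgroupV.
by move=> u vu; rewrite tree_autM tree_aut_fixV ?gX ?hX.
Qed.

(** By induction g fixes the parent of v, and it fixes all siblings of v, which
    are outside the subtree at v; so nothing is left for the image of v but v. *)
Lemma rist_fix G v g : rist G v g -> g v = v.
Proof.
case=> _ gP; elim/last_ind: v gP => [|v i IHv] gP; first by case: (tree_autP g).
have gv : g v = v.
  apply: gP; apply/negP => /size_prefix; rewrite size_rcons ltnn //.
have [j gj] := tree_aut_rcons g v i; rewrite gv in gj.
apply/eqP; rewrite gj eqseq_rcons eqxx /=; apply/negPn/negP => ji.
have : g (rcons v j) = rcons v j.
  apply: gP; apply/negP; rewrite prefixE size_rcons -(size_rcons v j) take_size.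
  by rewrite eqseq_rcons eqxx (negPf ji).
rewrite -[in RHS]gj => /tree_aut_inj/rcons_inj[E]; by rewrite E eqxx in ji.
Qed.

Lemma virt_sub_stab_level G n : virt_sub G (stab setT (level n)).
Proof.
exists {ffun n.-tuple 'I_d -> n.-tuple 'I_d}.
exists (fun g : tree_aut d => [ffun t : n.-tuple 'I_d => insubd t (g t)]).
move=> g h _ _ /ffunP gh; split=> // v /eqP vn; rewrite tree_autM.
suff <- : g v = h v by rewrite tree_autK.
have /(congr1 val) := gh (Tuple vn); rewrite !ffunE !val_insubd /=.
by rewrite !size_tree_aut vn.
Qed.

Lemma virt_sub_stab G H n : subgroup H -> virt_sub G H -> virt_sub G (stab H (level n)).
Proof.
move=> sH vG; apply: virt_sub_trans vG _.
apply: virt_subS (virt_subI sH _ (virt_sub_stab_level H n)) => //.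
by move=> g [[_ gP] Hg].
Qed.

Lemma section_morph v g h : h v = v ->
  tree_section v (g * h) = tree_section v g * tree_section v h.
Proof. by move=> hv; rewrite tree_sectionM hv. Qed.

Lemma subgroup_section v H : subgroup H -> (forall g, H g -> g v = v) ->
  subgroup (tree_section v @` H).
Proof.
by move=> sH Hv; apply: subgroup_image => // x y _ /Hv; exact: section_morph.
Qed.

Lemma virt_sub_section v G H : subgroup G -> (forall g, G g -> g v = v) ->
  virt_sub G H -> virt_sub (tree_section v @` G) (tree_section v @` (H `&` G)).
Proof.
by move=> sG Gv; apply: virt_sub_image => // x y _ /Gv; exact: section_morph.
Qed.

(** The sections at v of the stabilizer of v in G fill G, and sections at v form a
    homomorphism on that stabilizer, so they carry finite index to finite index. *)
Lemma virt_sub_section_self_replicating v G H : subgroup G -> self_replicating G ->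
  virt_sub G H ->
  virt_sub G (tree_section v @` (H `&` stab G [set v])).
Proof.
move=> sG rG vG; rewrite -{1}(rG v); apply: virt_sub_section.
- exact: subgroup_stab.
- by move=> g [_]; apply.
- by apply: virt_subS vG => // g [].
Qed.

Lemma section_in v G g : self_replicating G -> G g -> g v = v -> G (tree_section v g).
Proof.
by move=> rG Gg gv; rewrite -(rG v); exists g => //; split=> // _ ->.
Qed.

End Sections.

Section Transversals.
Variables (d : nat) (X : set (vertex d)).
Hypothesis d_gt0 : (0 < d)%N.
Hypothesis tX : Defs.transversal X.

(** Koenig's lemma: if some vertices at every level had no prefix in X, an
    infinite ray of vertices with no prefix in X would exist. *)
Lemma transversal_bound : exists n, forall v, size v = n ->
  exists2 u, X u & prefix u v.
Proof.
apply: contrapT => noN.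
pose bad v := forall n, exists2 w, size w = n & forall u, X u -> ~~ prefix u (v ++ w).
have bad0 : bad [::].
  move=> n; apply: contrapT => nb; apply: noN; exists n => v vn.
  apply: contrapT => nX; apply: nb; exists v => // u Xu.
  by apply/negP => uv; apply: nX; exists u.
have badS v : exists v', bad v -> bad v' /\ exists i, v' = rcons v i.
  have [bv|] := pselect (bad v); last by move=> nb; exists v.
  suff [i bi] : exists i, bad (rcons v i).
    by exists (rcons v i) => _; split=> //; exists i.
  apply: contrapT => nb.
  have /choice[N NP] : forall i, exists n, forall w, size w = n ->
      exists2 u, X u & prefix u (rcons v i ++ w).
    move=> i; apply: contrapT => nN; apply: nb; exists i => n.
    apply: contrapT => nw; apply: nN; exists n => w wn; apply: contrapT => nu.
    apply: nw; exists w => // u Xu; apply/negP => uw; apply: nu; by exists u.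
  have [[|i w] // wn wP] := bv (\max_i N i).+1.
  have Nw : (N i <= size w)%N by case: wn => ->; exact: leq_bigmax.
  have [u Xu uw] := NP i (take (N i) w) (size_takel Nw).
  have := wP _ Xu; rewrite -cat_rcons -(cat_take_drop (N i) w) catA.
  by rewrite (prefix_trans uw) // prefix_prefix.
have [f fP] := choice badS.
have bad_iter n : bad (iter n f [::]).
  by elim: n => //= n IHn; exact: (fP _ IHn).1.
have rf : ray (fun n => iter n f [::]).
  by split=> // n; exact: (fP _ (bad_iter n)).2.
have [v [[Xv [n _ rn]] _]] := tX rf.
have [[|//] _ /(_ v Xv)] := bad_iter n 0%N.
by rewrite cats0 rn prefix_refl.
Qed.

(** A vertex u of X deeper than the bound would have a prefix in X of length at
    most n, and a ray through u would meet X twice. *)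
Lemma transversal_level : exists n,
  (forall v, size v = n -> exists2 u, X u & prefix u v) /\
  (forall u, X u -> (size u <= n)%N).
Proof.
have [n nP] := transversal_bound; exists n; split=> // u Xu.
rewrite leqNgt; apply/negP => lt_nu.
pose i0 := Ordinal d_gt0.
pose r m := take m u ++ nseq (m - size u) i0.
have rr : ray r.
  split=> [|m]; first by rewrite /r take0.
  rewrite /r; have [um|mu] := leqP (size u) m.
    exists i0; rewrite !take_oversize ?(leq_trans um) // subSn //.
    by rewrite rcons_cat; congr (_ ++ _); elim: (m - size u)%N => //= k <-.
  exists (nth i0 u m); rewrite (take_nth i0) //.
  have /eqP -> : (m.+1 - size u == 0)%N by rewrite subn_eq0.
  by have /eqP -> : (m - size u == 0)%N; [rewrite subn_eq0 ltnW|rewrite !cats0].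
have [v [_ vu]] := tX rr.
have [v' Xv' v'u] := nP (take n u) (size_takel (ltnW lt_nu)).
have : v = u.
  apply: vu; split=> //; exists (size u) => //.
  by rewrite /r take_size subnn cats0.
have : v = v'.
  apply: vu; split=> //; exists (size v') => //.
  have v'u' : prefix v' u.
    by apply: prefix_trans v'u _; exact: prefix_take.
  rewrite /r; move: v'u'; rewrite prefixE => /eqP->.
  suff /eqP -> : (size v' - size u == 0)%N by rewrite cats0.
  rewrite subn_eq0 (leq_trans (size_prefix v'u)) // size_take lt_nu.
  exact: ltnW.
move=> -> E; have := size_prefix v'u.
by rewrite E size_take lt_nu leqNgt lt_nu.
Qed.

End Transversals.

(** * Section groups of finitely generated subgroups *)

Section BranchFacts.
Variable d : nat.
Hypothesis d_ge2 : (2 <= d)%N.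
Variable G : set (tree_aut d).
Hypothesis G_subgroup : subgroup G.
Hypothesis G_selfrep : self_replicating G.

(** Below a vertex of the transversal, taking a further section keeps the trivial
    group trivial and keeps finite index in G; so the transversal can be replaced
    by a whole level, whose pointwise stabilizer has finite index in that of X. *)
Lemma sections_dichotomy H : weak_subgroup_induction G ->
    subgroup H -> H `<=` G -> finitely_generated H ->
  exists n, forall v, size v = n ->
    (forall g, stab H (level n) g -> tree_section v g = 1) \/
    virt_sub G (tree_section v @` stab H (level n)).
Proof.
move=> wG sH HG fH; have [X tX XP] := wG H sH HG fH.
have [n [nX Xn]] := transversal_level (ltnW d_ge2) tX.
have i0 : 'I_d := Ordinal (ltnW d_ge2).
exists n => w /nX[v Xv /prefixP[u ->]].
(* Members of X have length at most n, so they are prefixes of words of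
   length n. *)
have sub_stab : stab H (level n) `<=` stab H X.
  move=> g [Hg gn]; split=> // v' Xv'.
  have : g (v' ++ nseq (n - size v') i0) = v' ++ nseq (n - size v') i0.
    by apply: gn; rewrite /level /= size_cat size_nseq subnKC //; exact: Xn.
  by case/tree_section_fix.
have sX : subgroup (stab H X) by exact: subgroup_stab.
have sn : subgroup (stab H (level n)) by exact: subgroup_stab.
have virt_stab : virt_sub (stab H X) (stab H (level n)).
  have := virt_sub_stab n sX (sub_virt_sub sX (@subset_refl _ _)).
  by apply: virt_subS => // g [[Hg _] gn].
have fixX g : stab H X g -> g v = v by case=> _; apply.
have fixn g : stab H (level n) g -> g v = v by move/sub_stab/fixX.
case: (XP v Xv) => [E|].
  left=> g Kg; rewrite tree_section_cat.
  suff -> : tree_section v g = 1 by exact: tree_section_id.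
  have : (tree_section v @` stab H X) (tree_section v g).
    by exists g => //; exact: sub_stab.
  by rewrite E.
rewrite G_selfrep => /(finite_index_virt_sub _ _).1.
move=> /(_ (subgroup_section sX fixX))[_ vG]; right.
have vK : virt_sub G (tree_section v @` stab H (level n)).
  apply: virt_sub_trans vG _; apply: virt_subS (virt_sub_section sX fixX virt_stab) => //.
  by move=> _ [g [Kg _] <-]; exists g.
have := virt_sub_section_self_replicating u G_subgroup G_selfrep vK.
apply: virt_subS => // _ [_ [[g Kg <-] _] <-].
by exists g => //; rewrite tree_section_cat.
Qed.

Hypothesis G_branch : branch G.

(** The level rigid stabilizer has finite index in G, so its section group at v
    has finite index in G, and the rigid stabilizers of the other vertices of
    the level contribute nothing to it. *)
Lemma virt_sub_section_rist v : virt_sub G (tree_section v @` rist G v).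
Proof.
have [_ _ /(_ (size v))] := G_branch.
pose gens := \bigcup_(u in level (size v)) rist G u.
have sR : subgroup (generated gens) by exact: subgroup_generated.
move=> /(finite_index_virt_sub _ sR).1[RG vR].
have := virt_sub_section_self_replicating v G_subgroup G_selfrep vR.
apply: virt_subS => // _ [g [Rg _] <-].
pose P := [set g : tree_aut d |
  g v = v /\ (tree_section v @` rist G v) (tree_section v g)].
have sr := subgroup_rist v G_subgroup.
have sS : subgroup (tree_section v @` rist G v).
  by apply: subgroup_section => // h /rist_fix.
suff : generated gens `<=` P by move=> /(_ _ Rg)[].
apply: generated_sub.
  have -> : P = tree_section v @^-1` (tree_section v @` rist G v) `&`
      stab setT [set v].
    apply/seteqP; split=> h.
      by case=> hv hP; split=> //; split=> // _ ->.
    by case=> hP [_ hv]; split=> //; exact: hv.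
  apply: subgroup_preimage => //.
    by apply: subgroup_stab; apply/subgroupP.
  by move=> x y _ [_ yv]; apply: section_morph; exact: yv.
move=> h [u /= su ru]; case: (eqVneq u v) => [uv|uv].
  by rewrite uv in ru; split; [exact: rist_fix ru|exists h].
have hv w : h (v ++ w) = v ++ w.
  case: ru => _; apply; rewrite prefixE su take_size_cat //.
  by rewrite eq_sym.
have [hv0 h1] := tree_section_fix_uniq (h := 1) hv.
by split=> //; rewrite h1; exact: subgroup1.
Qed.

(** If the section group C were of finite index in G, it would meet the infinite
    groups rist G [:: i0] and rist G [:: i1] in sections of g ^+ m and g ^+ n with
    m, n > 0.  The section of g ^+ (m * n) then lies in both rigid stabilizers, so
    it is trivial and C is finite; but G is infinite. *)
Lemma branch_not_virt_cyclic (g : tree_aut d) (v : vertex d) (K : set (tree_aut d)) :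
    subgroup K -> K `<=` generated [set g] -> (forall x, K x -> x v = v) ->
  ~ virt_sub G (tree_section v @` K).
Proof.
move=> sK Kg Kv; set C := tree_section v @` K => vC.
have sC : subgroup C by exact: subgroup_section.
have [_ rinf _] := G_branch.
have secX x n : K x -> tree_section v (x ^+ n) = tree_section v x ^+ n.
  move=> Kx; elim: n => [|n IHn]; first exact: tree_section_id.
  by rewrite !expgS section_morph ?IHn //; apply: Kv; exact: subgroupX.
have secV x : K x -> tree_section v x^-1 = (tree_section v x)^-1.
  by apply: morph_onV => // y z _ /Kv; exact: section_morph.
have pick u : exists n,
    [/\ (0 < n)%N, K (g ^+ n) & rist G u (tree_section v (g ^+ n))].
  have sr := subgroup_rist u G_subgroup.
  have : virt_sub (rist G u) (C `&` rist G u).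
    apply: virt_subI => //; apply: (@virt_subS _ G) vC => //. by move=> x [].
  move=> /finite_virt_sub1 fin.
  have [a [Ca ra] a1] : exists2 a, (C `&` rist G u) a & a <> 1.
    apply: contrapT => nex; apply: (rinf u); apply: fin => a Ca.
    by apply: contrapT => a1; apply: nex; exists a.
  case: Ca ra a1 => x Kx <- rx x1.
  have [[|k] [xE|xE]] := generated1P (Kg _ Kx).
  - by case: x1; rewrite xE tree_section_id.
  - by case: x1; rewrite -[x]invgK xE invg1 tree_section_id.
  - by exists k.+1; rewrite -xE.
  - exists k.+1; rewrite -xE secV //.
    by split=> //; exact: subgroupV.
pose i0 : 'I_d := Ordinal (ltnW d_ge2).
pose i1 : 'I_d := Ordinal d_ge2.
have [m [m0 Km rm]] := pick [:: i0].
have [n [n0 Kn rn]] := pick [:: i1].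
have N0 : (0 < m * n)%N by rewrite muln_gt0 m0.
have KN : K (g ^+ (m * n)) by rewrite expgnA; exact: subgroupX.
have secN : tree_section v (g ^+ (m * n)) = 1.
  have r0 : rist G [:: i0] (tree_section v (g ^+ (m * n))).
    by rewrite expgnA secX //; apply: subgroupX => //; exact: subgroup_rist.
  have r1 : rist G [:: i1] (tree_section v (g ^+ (m * n))).
    by rewrite mulnC expgnA secX //; apply: subgroupX => //; exact: subgroup_rist.
  apply: tree_aut_eq => w; rewrite tree_aut1.
  case p0 : (prefix [:: i0] w); last by apply: r0.2; rewrite p0.
  apply: r1.2; case: w p0 => [|i w] //; rewrite prefix_cons => /andP[/eqP <- _].
  by rewrite prefix_cons.
apply: (rinf [:: i0]); apply: (@finite_virt_sub1 _ _ [set 1]) => //.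
apply: (@virt_subS _ G _ [set 1] _ _ _) => //; first by move=> x [].
apply: virt_sub_trans vC _.
have modN k : K (g ^+ k) ->
    tree_section v (g ^+ k) = tree_section v (g ^+ (k %% (m * n))).
  set N := (m * n)%N in N0 KN secN *.
  have kE : k = (N * (k %/ N) + k %% N)%N by rewrite mulnC -divn_eq.
  move=> Kk; have gE : g ^+ (k %% N) = (g ^+ N ^+ (k %/ N))^-1 * g ^+ k.
    by rewrite {3}kE expgnDr expgnA mulKg.
  have Kr : K (g ^+ (k %% N)).
    by rewrite gE; apply: subgroupVM => //; exact: subgroupX.
  rewrite {1}kE expgnDr expgnA section_morph ?(Kv _ Kr) // (secX (g ^+ N)) //.
  by rewrite secN expg1n mul1g.
(* Every element of C is the section of g ^+ r or its inverse, r < m * n. *)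
pose e (p : 'I_(m * n) * bool) := let s := tree_section v (g ^+ p.1) in
  if p.2 then s^-1 else s.
have eP c : C c -> exists p, c = e p.
  case=> x Kx <-; have [k xE] := generated1P (Kg _ Kx).
  pose r := Ordinal (ltn_pmod k N0).
  case: xE => xE; first by exists (r, false); rewrite /e /= -modN -xE.
  exists (r, true); rewrite /e /= -modN -xE; last exact: subgroupV.
  by rewrite secV // invgK.
exists ('I_(m * n) * bool)%type.
exists (fun c => xget (Ordinal (ltn_pmod 0 N0), true) [set p | c = e p]).
move=> a b /eP[p pE] /eP[q qE].
case: xgetP => [p' _ p'E|/(_ p)//]; case: xgetP => [q' _ q'E|/(_ q)//] pq.
by rewrite p'E q'E pq mulVg.
Qed.

End BranchFacts.

(** * Torsion, and transitivity below a deep level *)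

Section TorsionAndOrbits.
Variable d : nat.
Hypothesis d_ge2 : (2 <= d)%N.
Variable G : set (tree_aut d).
Hypothesis G_subgroup : subgroup G.
Hypothesis G_branch : branch G.

(** A nontrivial section group of a cyclic subgroup would have to be of finite
    index in G, which is impossible for a branch group, so the elements of the
    cyclic group that fix a certain level pointwise are trivial; some positive
    power of g is one of them. *)
Lemma torsion_of_weak_subgroup_induction :
  self_replicating G -> weak_subgroup_induction G -> torsion G.
Proof.
move=> rG wG g Gg; pose H := generated [set g].
have sH : subgroup H by exact: subgroup_generated.
have HG : H `<=` G by apply: generated_sub => // _ ->.
have fH : finitely_generated H by exists [set g] => //; exact: finite_set1.
have [n nP] := sections_dichotomy d_ge2 G_subgroup rG wG sH HG fH.
have sK : subgroup (stab H (level n)) by exact: subgroup_stab.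
have K1 k : stab H (level n) k -> k = 1.
  move=> Kk; apply: (@tree_aut_eq1 _ n) => v vn; split; first exact: Kk.2.
  case: (nP v vn) => [|vG]; first exact.
  have Kg : stab H (level n) `<=` generated [set g] by move=> x [].
  have Kv x : stab H (level n) x -> x v = v by case=> _; exact.
  by case: (branch_not_virt_cyclic d_ge2 G_subgroup G_branch sK Kg Kv vG).
have vH := virt_sub_stab n sH (sub_virt_sub sH (@subset_refl _ _)).
have [k k0 kP] := virt_sub_expg sH vH (generated_gen (erefl g)).
by exists k => //; exact: K1.
Qed.

(** The number of L-orbits on a level is bounded by the index of L.  Take a level m
    where it is maximal, with W a set of orbit representatives.  Extending the
    members of W by a constant word gives orbit representatives at every deeper
    level, so the orbit of a vertex is determined by the orbit of its prefix of
    length m. *)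
Lemma virt_sub_eventually_transitive L : subgroup L -> virt_sub G L ->
  exists m, forall w x y, (m <= size w)%N -> size x = size y ->
    exists2 l, L l & l (w ++ x) = w ++ y.
Proof.
move=> sL [T [c cP]]; have [Gtrans _ _] := G_branch.
pose i0 : 'I_d := Ordinal (ltnW d_ge2).
have /choice[gam gamP] : forall v, exists g, G g /\ g (nseq (size v) i0) = v.
  move=> v; have [||g Gg gv] := Gtrans (size v) (nseq (size v) i0) v; last by exists g.
    by rewrite /level /= size_nseq.
  by [].
pose indep m k := exists W : seq (vertex d), [/\ size W = k, uniq W,
  forall w, w \in W -> size w = m &
  forall w w' l, w \in W -> w' \in W -> L l -> l w = w' -> w = w'].
have indep_bound m k : indep m k -> (k <= #|T|)%N.
  case=> W [<- uW sW iW].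
  pose f w := c (gam w)^-1.
  rewrite -(size_map f W).
  have /card_uniqP <- : uniq (map f W).
    rewrite map_inj_in_uniq // => w w' wW w'W ff'.
    have [Gw wE] := gamP w; have [Gw' w'E] := gamP w'.
    apply/esym; apply: (iW _ _ ((gam w)^-1^-1 * (gam w')^-1)) => //.
      by apply: cP => //; exact: subgroupV.
    by rewrite invgK tree_autM -{2}w'E tree_autK -{2}wE !sW.
  exact: max_card.
pose P k := `[< exists m, indep m k >].
have P0 : exists k, P k by exists 0; apply/asboolP; exists 0; exists [::]; split.
have Pb k : P k -> (k <= #|T|)%N by move/asboolP => [m]; exact: indep_bound.
case: (ex_maxnP P0 Pb) => k /asboolP[m [W [sizeW uW sW iW]]] maxW {P0 Pb}.
(* Otherwise z could be added to the extended representatives, against the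
   maximality of their number. *)
have hits z : (m <= size z)%N -> exists l u, [/\ L l, u \in W &
    l z = u ++ nseq (size z - m) i0].
  move=> mz; apply: contrapT => nz; set j := (size z - m)%N in nz.
  suff : P k.+1 by move/maxW; rewrite ltnn.
  apply/asboolP; exists (size z); exists (z :: [seq u ++ nseq j i0 | u <- W]).
  have zP l u : L l -> u \in W -> l z <> u ++ nseq j i0.
    by move=> Ll uW' lz; apply: nz; exists l, u.
  split; first by rewrite /= size_map sizeW.
  - rewrite /= map_inj_uniq ?uW ?andbT.
      apply/negP => /mapP[u uW' zE]; apply: (zP 1 u) => //; exact: subgroup1.
    move=> u u' E.
    have := congr1 (rev \o drop j \o rev) E; rewrite /= !rev_cat.
    by rewrite !drop_size_cat ?size_rev ?size_nseq // !revK.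
  - move=> w; rewrite inE => /orP[/eqP-> //|/mapP[u uW' ->]].
    by rewrite size_cat size_nseq sW // subnKC.
  move=> w w' l; rewrite !inE => /orP[/eqP->|/mapP[u uW' ->]].
    move=> /orP[/eqP-> //|/mapP[u' u'W ->]] Ll lE.
    by case: (zP l u').
  move=> /orP[/eqP-> Ll lE|/mapP[u' u'W ->] Ll lE].
    case: (zP l^-1 u); rewrite //; first exact: subgroupV.
    by rewrite -lE tree_autK.
  congr (_ ++ _); apply: (iW _ _ l) => //; move: lE.
  rewrite tree_sectionP => /eqP; rewrite eqseq_cat ?size_tree_aut ?sW //.
  by case/andP=> /eqP.
exists m => w x y mw xy.
have mwt t : (m <= size (w ++ t))%N by rewrite size_cat (leq_trans mw) ?leq_addr.
have [l [u [Ll uW' lE]]] := hits (w ++ x) (mwt x).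
have [l' [u' [Ll' u'W lE']]] := hits (w ++ y) (mwt y).
have E : u = u'.
  apply: (iW _ _ (l' * l^-1)) => //; first by apply: subgroupM => //; exact: subgroupV.
  have lw : l (take m w) = u.
    by rewrite -(takel_cat x mw) tree_aut_take lE take_size_cat ?sW.
  have lw' : l' (take m w) = u'.
    by rewrite -(takel_cat y mw) tree_aut_take lE' take_size_cat ?sW.
  by rewrite tree_autM -lw tree_autK.
exists (l'^-1 * l); first exact: subgroupVM.
by rewrite tree_autM lE E size_cat xy -size_cat -lE' tree_autK.
Qed.

End TorsionAndOrbits.

(** * Elements acting below a single vertex *)

Section IndependentSections.
Variable d : nat.
Hypothesis d_ge2 : (2 <= d)%N.
Variable G : set (tree_aut d).
Hypothesis G_subgroup : subgroup G.
Hypothesis G_fg : finitely_generated G.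
Hypothesis G_selfrep : self_replicating G.
Hypothesis G_branch : branch G.
Hypothesis G_torsion : torsion G.

Implicit Types (g h k : tree_aut d) (u v w x y z : vertex d).

(** When K acts faithfully on the subtrees at S, sections embed the pointwise
    stabilizer of S in K into a direct product indexed by S, and this is the
    intersection of the image with the factor at u.  The image has finite index in
    the product as soon as each of these intersections has it in its factor. *)
Definition isolated (K : set (tree_aut d)) (S : seq (vertex d)) u :
    set (tree_aut d) :=
  [set x | exists2 k, K k & (forall z, k (u ++ z) = u ++ x z) /\
     forall y, y \in S -> y != u -> forall z, k (y ++ z) = y ++ z].

Variable K : set (tree_aut d).
Hypothesis K_subgroup : subgroup K.
Hypothesis K_sub_G : K `<=` G.
Variable n : nat.
Hypothesis K_fix : forall v, size v = n -> forall g, K g -> g v = v.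
Hypothesis K_dichotomy : forall v, size v = n ->
  (forall g, K g -> tree_section v g = 1) \/ virt_sub G (tree_section v @` K).

Definition trivial_on_orbit g w := forall k x, K k -> g (k (w ++ x)) = k (w ++ x).

Lemma trivial_on_orbitJ g w l : K l -> trivial_on_orbit g w ->
  trivial_on_orbit (l * g * l^-1) w.
Proof.
move=> Kl tg k x Kk; rewrite !tree_autM.
by rewrite (tg (l^-1 * k)) ?tree_autM ?tree_autKV //; exact: subgroupVM.
Qed.

(** Below a vertex v of length n with section group of finite index in G, lemma
    virt_sub_eventually_transitive applies to that section group; m is large
    enough for all the finitely many v at once. *)
Lemma trivial_or_transitive : exists m, (n <= m)%N /\ forall w, size w = m ->
  (forall g x, K g -> g (w ++ x) = w ++ x) \/
  (forall x y, size x = size y -> exists2 k, K k & k (w ++ x) = w ++ y).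
Proof.
have /choice[m mP] : forall v, exists m, size v = n -> forall w, (m <= size w)%N ->
  (forall g x, K g -> g (v ++ w ++ x) = v ++ w ++ x) \/
  (forall x y, size x = size y -> exists2 k, K k & k (v ++ w ++ x) = v ++ w ++ y).
  move=> v; have [vn|nvn] := pselect (size v = n); last by exists 0.
  case: (K_dichotomy vn) => [K1|vG].
    exists 0 => _ w _; left=> g x Kg.
    by rewrite tree_sectionP K1 // K_fix.
  have sL : subgroup (tree_section v @` K).
    by apply: subgroup_section => // g Kg; exact: K_fix.
  have [m mP] := virt_sub_eventually_transitive d_ge2 G_subgroup G_branch sL vG.
  exists m => _ w mw; right=> x y xy.
  have [_ [k Kk <-] lE] := mP w x y mw xy.
  by exists k => //; rewrite tree_sectionP lE K_fix.
exists (n + \max_(t : n.-tuple 'I_d) m t)%N; split=> [|w wm]; first exact: leq_addr.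
have nw : (n <= size w)%N by rewrite wm leq_addr.
have mw : (m (take n w) <= size (drop n w))%N.
  rewrite size_drop wm addKn.
  have tn : size (take n w) == n by rewrite size_takel.
  exact: (leq_bigmax (Tuple tn)).
have wE x : w ++ x = take n w ++ drop n w ++ x by rewrite catA cat_take_drop.
case: (mP (take n w) (size_takel nw) _ mw) => H; [left|right].
  by move=> g x Kg; rewrite wE; exact: H.
by move=> x y xy; have [k Kk kE] := H x y xy; exists k; rewrite ?wE.
Qed.

(** Faithfulness on the subtrees at the K-orbits of s, not only at s itself: the
    kernel of the action on a union of orbits is normal in K, so a vertex moved
    by it can be carried to other vertices by transitivity. *)
Definition faithful (s : seq (vertex d)) :=
  forall g, K g -> (forall w, w \in s -> trivial_on_orbit g w) -> g = 1.

(** A list of minimal size among the faithful lists of vertices of length m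
    has this property, because removing w from it destroys faithfulness.  The list
    of all vertices of length m is faithful. *)
Lemma minimal_faithful m : exists s : seq (vertex d),
  [/\ forall w, w \in s -> size w = m, faithful s &
  forall w, w \in s -> exists g, [/\ K g, g <> 1 &
    forall w', w' \in s -> w' != w -> trivial_on_orbit g w']].
Proof.
pose P j := `[< exists s : seq (vertex d),
  [/\ size s = j, forall w, w \in s -> size w = m & faithful s] >].
have exP : exists j, P j.
  pose s := map val (enum {: m.-tuple 'I_d}).
  exists (size s); apply/asboolP; exists s; split=> //.
    by move=> w /mapP[t _ ->]; exact: size_tuple.
  move=> g Kg gs; apply: (@tree_aut_eq1 _ m) => v /eqP vm.
  have vs : v \in s by apply/mapP; exists (Tuple vm); rewrite // mem_enum.
  have gv x : g (v ++ x) = v ++ x by have := gs v vs 1 x (subgroup1 K_subgroup).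
  have gv0 : g v = v by have := gv [::]; rewrite cats0.
  by split=> //; apply/esym/tree_section_uniq => x; rewrite gv gv0.
case: (ex_minnP exP) => k /asboolP[s [sk sm fs]] mink.
exists s; split=> // w ws; apply: contrapT => nex.
have := mink (size (rem w s)); rewrite size_rem // sk.
have s0 : (0 < k)%N by rewrite -sk; case: (s) ws.
have -> : (k <= k.-1)%N = false by apply/negbTE; rewrite -ltnNge prednK.
have pw := perm_to_rem ws.
move=> Pk; suff : false by []; apply: Pk; apply/asboolP; exists (rem w s); split.
- by rewrite size_rem // sk.
- by move=> w' /mem_rem; exact: sm.
move=> g Kg gw; apply: contrapT => g1; apply: nex; exists g; split=> // w' w's ww'.
by apply: gw; move: w's; rewrite (perm_mem pw) inE (negPf ww').
Qed.

(** The element f := g * a^-1 * g^-1 * a acts on the subtree at u as a does: g^-1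
    takes that subtree to another one below v, where a is trivial.  The element
    [~ f, b] then acts as [~ a, b] below u.  Elsewhere below v, f preserves the
    complement of the subtree at u and b is trivial there, so the commutator is
    trivial; and where g is trivial on a K-orbit, so are f and the commutator. *)
Lemma commutator_isolates u v u' g a b :
    u = v ++ u' -> size v = n -> K g -> g u <> u -> K a -> K b ->
    rist G u' (tree_section v a) -> rist G u' (tree_section v b) ->
  exists c, [/\ K c,
    forall z, c (u ++ z) = u ++ [~ tree_section u a, tree_section u b] z,
    forall r z, size r = size u' -> r != u' -> c (v ++ r ++ z) = v ++ r ++ z &
    forall w, trivial_on_orbit g w -> trivial_on_orbit c w].
Proof.
move=> uE vn Kg gu Ka Kb ra rb.
pose f := g * a^-1 * g^-1 * a.
have Kf : K f.
  by do !apply: subgroupM => //; exact: subgroupV.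
have out h r : K h -> rist G u' (tree_section v h) -> ~~ prefix u' r ->
    h (v ++ r) = v ++ r.
  by move=> Kh [_ hP] pr; rewrite tree_sectionP hP // K_fix.
have fix_u h : K h -> rist G u' (tree_section v h) -> h u = u.
  by move=> Kh rh; rewrite uE tree_sectionP (rist_fix rh) K_fix.
have au z : a (u ++ z) = u ++ tree_section u a z by rewrite tree_sectionP fix_u.
have bu z : b (u ++ z) = u ++ tree_section u b z by rewrite tree_sectionP fix_u.
have fu z : f (u ++ z) = u ++ tree_section u a z.
  rewrite /f !tree_autM au; set t := tree_section u a z.
  have gVu : g^-1 u = v ++ tree_section v g^-1 u'.
    by rewrite uE tree_sectionP (K_fix vn) //; exact: subgroupV.
  suff E : a^-1 (g^-1 (u ++ t)) = g^-1 (u ++ t) by rewrite E tree_autKV.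
  apply: tree_aut_fixV; rewrite tree_sectionP gVu -catA.
  apply: out => //; apply/negP; rewrite prefixE take_size_cat ?size_tree_aut //.
  by move=> /eqP E; apply: gu; rewrite {1}uE -{1}E -gVu tree_autKV.
have fw w : trivial_on_orbit g w -> trivial_on_orbit f w.
  move=> tw l z Kl; rewrite /f !tree_autM.
  have := tw _ z (subgroupM K_subgroup Ka Kl); rewrite tree_autM => /tree_aut_fixV ->.
  by rewrite tree_autK; exact: tw.
clearbody f.
have bVu z : b^-1 (u ++ z) = u ++ (tree_section u b)^-1 z.
  by apply: (@tree_aut_inj _ b); rewrite tree_autKV bu tree_autKV.
have fVu z : f^-1 (u ++ z) = u ++ (tree_section u a)^-1 z.
  by apply: (@tree_aut_inj _ f); rewrite tree_autKV fu tree_autKV.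
exists [~ f, b]; split.
- rewrite /commg /conjg; do !apply: subgroupM => //; exact: subgroupV.
- by move=> z; rewrite /commg /conjg !tree_autM bu fu bVu fVu.
- move=> r z ru ru'.
  have pr t : size t = size u' -> t != u' -> ~~ prefix u' (t ++ z).
    by move=> tu tu'; rewrite prefixE take_size_cat.
  rewrite /commg /conjg !tree_autM (out b) ?pr //.
  pose t := tree_section v f r.
  have fE z' : f (v ++ r ++ z') = v ++ t ++ tree_section r (tree_section v f) z'.
    by rewrite tree_sectionP (K_fix vn) // tree_sectionP.
  have -> : b^-1 (f (v ++ r ++ z)) = f (v ++ r ++ z); last by rewrite tree_autK.
  apply: tree_aut_fixV; rewrite fE; apply: out => //.
  rewrite prefixE take_size_cat ?size_tree_aut //; apply/negP => /eqP tE.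
  have := fE [::]; rewrite cats0 tE catA -uE.
  set z' := tree_section _ _ _ => E.
  have z'0 : z' = [::].
    apply: size0nil; rewrite /z' size_tree_aut //.
  move: E; rewrite z'0 cats0 => E.
  have := fu [::]; rewrite cats0 => fu0.
  have s0 : tree_section u a [::] = [::] by apply: size0nil; rewrite size_tree_aut.
  move: fu0; rewrite s0 cats0 -{2}E => /tree_aut_inj.
  rewrite uE => /eqP; rewrite eqseq_cat // eqxx /= => /eqP E'.
  by rewrite E' eqxx in ru'.
move=> w /fw{}fw k z Kk; rewrite /commg /conjg !tree_autM.
have := fw _ z (subgroupM K_subgroup Kb Kk); rewrite tree_autM => ->.
by rewrite tree_autK; apply: tree_aut_fixV; exact: fw.
Qed.

(** S consists of the vertices of length m + p below the K-orbits of a minimal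
    faithful list s, with p such that the element of K isolating w in s has
    conjugates moving every extension of w by at least p letters.  For u in S, the
    commutators of the finite-index subgroup M of G, made of the sections at u of
    the elements of K whose section at v is in the rigid stabilizer of u', are
    isolated at u. *)
Lemma isolated_sections : exists m (S : seq (vertex d)),
  [/\ uniq S, forall u, u \in S -> size u = m,
      forall g, K g -> (forall u z, u \in S -> g (u ++ z) = u ++ z) -> g = 1 &
      forall u, u \in S -> virt_sub G (isolated K S u)].
Proof.
have [m [nm mP]] := trivial_or_transitive.
have [s [sm fs sP]] := minimal_faithful m.
pose mover w y g := K g /\ g (w ++ y) <> w ++ y /\
  forall w', w' \in s -> w' != w -> trivial_on_orbit g w'.
have /choice[j jP] : forall w, exists j, w \in s ->
    forall y, (j <= size y)%N -> exists g, mover w y g.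
  move=> w; have [ws|nws] := boolP (w \in s); last by exists 0.
  have [g0 [Kg0 g01 g0s]] := sP w ws.
  have [k [x [Kk kx]]] : exists k x, K k /\ g0 (k (w ++ x)) <> k (w ++ x).
    apply: contrapT => nx; apply: g01; apply: fs => // w' w's.
    have [->|] := eqVneq w' w; last exact: g0s.
    by move=> k x Kk; apply: contrapT => kx; apply: nx; exists k, x.
  (* Conjugating by k brings the vertex that g0 moves below w itself. *)
  pose g := k^-1 * g0 * k^-1^-1.
  have Kk' := subgroupV K_subgroup Kk.
  have Kg : K g by rewrite /g; do !apply: subgroupM => //; exact: subgroupV.
  have gx : g (w ++ x) <> w ++ x.
    rewrite /g invgK !tree_autM => E; apply: kx.
    by rewrite -{2}E tree_autKV.
  have gs w' : w' \in s -> w' != w -> trivial_on_orbit g w'.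
    by move=> w's ww'; apply: trivial_on_orbitJ => //; exact: g0s.
  exists (size x) => _ y xy.
  case: (mP w (sm w ws)) => [K1|trans]; first by case: gx; exact: K1.
  have [l Kl lE] := trans x (take (size x) y) (esym (size_takel xy)).
  (* By transitivity below w, the prefix of w ++ y as long as w ++ x is moved by
     a conjugate of g, and so is every vertex below it. *)
  exists (l * g * l^-1); split; [|split].
  - by do !apply: subgroupM => //; exact: subgroupV.
  - move=> E; apply: gx; apply: (@tree_aut_inj _ l).
    rewrite lE; move: E.
    rewrite -{1 2}(cat_take_drop (size x) y) catA => /tree_section_fix[+ _].
    by rewrite -lE !tree_autM tree_autK lE.
  - by move=> w' w's ww'; apply: trivial_on_orbitJ => //; exact: gs.
pose p := \max_(w <- s) j w.
pose below w u := exists2 k, K k & exists y, u = k (w ++ y).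
pose S := [seq u <- map val (enum {: (m + p).-tuple 'I_d}) |
  `[< exists2 w, w \in s & below w u >]].
have SP u : u \in S <-> size u = (m + p)%N /\ exists2 w, w \in s & below w u.
  rewrite mem_filter; split=> [/andP[/asboolP ? /mapP[t _ uE]]|[/eqP us ?]].
    by split; rewrite // uE size_tuple.
  apply/andP; split; first exact/asboolP.
  by apply/mapP; exists (Tuple us); rewrite // mem_enum.
have i0 : 'I_d := Ordinal (ltnW d_ge2).
exists (m + p)%N, S; split.
- by rewrite filter_uniq // map_inj_uniq ?enum_uniq //; exact: val_inj.
- by move=> u /SP[].
- move=> g Kg gS; apply: fs => // w ws k x Kk.
  (* The vertex k (w ++ x) may be above S, so it is padded to one below S. *)
  pose q := (k (w ++ x ++ nseq p i0)).
  have sq : (m + p <= size q)%N.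
    by rewrite size_tree_aut !size_cat size_nseq (sm _ ws) leq_add2l leq_addl.
  have : g q = q.
    rewrite -(cat_take_drop (m + p) q); apply: gS; apply/SP.
    split; first exact: size_takel.
    exists w => //; exists k => //; exists (take p (x ++ nseq p i0)).
    by rewrite -tree_aut_take take_cat (sm _ ws) ltnNge leq_addr addKn.
  by rewrite /q catA [k (_ ++ nseq _ _)]tree_sectionP => /tree_section_fix[].
move=> u uS; have [su [w ws [k Kk [y uE]]]] := (SP u).1 uS.
have sy : size y = p.
  move: su; rewrite uE size_tree_aut size_cat (sm _ ws) => /eqP.
  by rewrite eqn_add2l => /eqP.
have jy : (j w <= size y)%N by rewrite sy; exact: leq_bigmax_seq.
have [g0 [Kg0 [g0y g0s]]] := jP w ws y jy.
pose g := k * g0 * k^-1.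
have Kg : K g by rewrite /g; do !apply: subgroupM => //; exact: subgroupV.
have gu : g u <> u.
  rewrite /g uE !tree_autM tree_autK => /tree_aut_inj; exact: g0y.
have gs w' : w' \in s -> w' != w -> trivial_on_orbit g w'.
  by move=> w's ww'; apply: trivial_on_orbitJ => //; exact: g0s.
pose v := take n u; pose u' := drop n u.
have nu : (n <= size u)%N by rewrite su (leq_trans nm) // leq_addr.
have vn : size v = n by exact: size_takel.
have uvu : u = v ++ u' by rewrite cat_take_drop.
have vG : virt_sub G (tree_section v @` K).
  case: (K_dichotomy vn) => // K1; case: gu.
  by rewrite uvu tree_sectionP K1 // K_fix.
have Kv l : K l -> l v = v by exact: K_fix.
set L := tree_section v @` K in vG.
have sL : subgroup L by exact: subgroup_section.
have sR : subgroup (rist G u') by exact: subgroup_rist.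
have sLR := subgroupI sL sR.
have fLR l : (L `&` rist G u') l -> l u' = u' by case=> _ /rist_fix.
pose M := tree_section u' @` (L `&` rist G u').
have sM : subgroup M by exact: subgroup_section.
have MG : M `<=` G.
  move=> _ [x [_ rx] <-]; apply: section_in => //; first exact: rx.1.
  exact: rist_fix rx.
have vM : virt_sub G M.
  apply: virt_sub_trans (virt_sub_section_rist G_subgroup G_selfrep G_branch u') _.
  apply: virt_sub_section => //; first by move=> x /rist_fix.
  by apply: (@virt_subS _ G) vG => // x [].
have Ku (x : tree_aut d) : isolated K S u x -> G x.
  case=> l Kl [lu _].
  have [lu0 <-] := tree_section_fix_uniq lu.
  by apply: section_in => //; exact: K_sub_G.
apply: (virt_sub_derived G_subgroup G_fg G_torsion sM MG vM).
  apply/subgroupP; split; first by exists 1; [exact: subgroup1|].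
  move=> x1 x2 [k1 Kk1 [k1u k1S]] [k2 Kk2 [k2u k2S]].
  have k2V z : k2^-1 (u ++ z) = u ++ x2^-1 z.
    by apply: (@tree_aut_inj _ k2); rewrite tree_autKV k2u tree_autKV.
  exists (k1 * k2^-1); first by apply: subgroupM => //; exact: subgroupV.
  split=> [z|y' y'S y'u z]; first by rewrite tree_autM k2V k1u.
  by rewrite tree_autM tree_aut_fixV ?k1S ?k2S.
move=> _ _ [_ [[a Ka <-] ra] <-] [_ [[b Kb <-] rb] <-].
have [c [Kc cu cv cw]] := commutator_isolates uvu vn Kg gu Ka Kb ra rb.
rewrite -!tree_section_cat -uvu; exists c => //; split=> // y' y'S y'u z.
have [sy' [w' w's [k' Kk' [t yE]]]] := (SP y').1 y'S.
have [ww|ww] := eqVneq w' w; last first.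
  set q := (tree_section (w' ++ t) k')^-1 z.
  have -> : y' ++ z = k' (w' ++ (t ++ q)).
    by rewrite catA tree_sectionP -yE /q tree_autKV.
  exact: cw (gs w' w's ww) _ _ Kk'.
have take_below l r : K l -> take n (l (w ++ r)) = take n w.
  move=> Kl; have nw : (n <= size w)%N by rewrite (sm _ ws).
  by rewrite -tree_aut_take takel_cat // K_fix // size_takel.
have y'v : take n y' = v by rewrite yE ww /v uE !take_below.
rewrite -(cat_take_drop n y') y'v -catA; apply: cv.
  by rewrite !size_drop sy' su.
by apply: contraNneq y'u => E; rewrite -(cat_take_drop n y') y'v E -uvu.
Qed.

End IndependentSections.

(** * Reduction of the exponent and proof of the theorem *)

Section DirectPowers.
Variables (d : nat) (G : set (tree_aut d)).
Hypothesis G_subgroup : subgroup G.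
Hypothesis G_selfrep : self_replicating G.
Hypothesis G_branch : branch G.

(** Replace the first coordinate, restricted to the stabilizer of the first
    level, by its d sections at the vertices of that level. *)
Lemma commensurable_direct_power_shift k :
  commensurable (direct_power G k.+1) (direct_power G (d + k)).
Proof.
pose A := direct_power G k.+1.
have sA : subgroup A by exact: subgroup_direct_power.
pose ev (f : {ffun 'I_k.+1 -> tree_aut d}) := f ord0.
have evM x y : A x -> A y -> ev (x * y) = ev x * ev y by rewrite /ev ffunE.
have sS : subgroup (stab G (level 1)) by exact: subgroup_stab.
pose A1 := ev @^-1` stab G (level 1) `&` A.
have A1P f (j : 'I_d) : A1 f -> f ord0 [:: j] = [:: j] by case=> [[_ H] _]; exact: H.
pose phi (i : 'I_(d + k)) (f : {ffun 'I_k.+1 -> tree_aut d}) :=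
  match fintype.split i with
  | inl j => tree_section [:: j] (f ord0) | inr j => f (lift ord0 j) end.
apply: (@commensurable_direct_power _ _ _ A1 _ _ phi).
- exact: subgroup_preimage.
- by move=> f [].
- apply: virt_subI => //; apply: (virt_sub_preimage sA evM (C := G)).
    by move=> x; apply.
  exact: virt_sub_stab (sub_virt_sub G_subgroup (@subset_refl _ _)).
- move=> i x y Ax Ay; rewrite /phi; case: (fintype.split i) => j; last by rewrite ffunE.
  by rewrite ffunE section_morph // A1P.
- move=> i f Af; rewrite /phi; case: (fintype.split i) => j; last exact: Af.2.
  by apply: section_in => //; [exact: Af.2|exact: A1P].
- move=> f Af f1; apply/ffunP => i; rewrite ffunE.
  case: (unliftP ord0 i) => [j|] ->.
    by have := f1 (rshift d j); rewrite /phi (unsplitK (inr j)).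
  apply: (@tree_aut_eq1 _ 1) => -[|j [|]] // _; split; first exact: A1P.
  by have := f1 (lshift k j); rewrite /phi (unsplitK (inl j)).
move=> i; have [i' ->] : exists i', i = unsplit i'.
  by exists (fintype.split i); rewrite splitK.
case: i' => j.
  apply: virt_subS (virt_sub_section_rist G_subgroup G_selfrep G_branch [:: j]) => //.
  move=> _ [g rg <-].
  pose f : {ffun 'I_k.+1 -> tree_aut d} :=
    [ffun l => if l == ord0 then g else 1].
  have f0 : f ord0 = g by rewrite ffunE eqxx.
  have g1 (l : 'I_d) w : l != j -> g (l :: w) = l :: w.
    by move=> lj; apply: rg.2; rewrite prefix_cons eq_sym (negPf lj).
  exists f; split.
  - split; last first.
      move=> l; rewrite ffunE.
      by case: eqP => _; [exact: rg.1|exact: subgroup1].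
    rewrite /preimage /= /ev f0; split; first exact: rg.1.
    move=> [|l [|]] // _; have [->|lj] := eqVneq l j; first exact: rist_fix rg.
    exact: g1.
  - by rewrite /phi (unsplitK (inl j)) f0.
  move=> l; have [l' ->] : exists l', l = unsplit l'.
    by exists (fintype.split l); rewrite splitK.
  case: l' => l'; rewrite /phi unsplitK ?f0 => ll; last by rewrite ffunE.
  have lj : l' != j by apply: contraNneq ll => ->.
  apply/esym/tree_section_uniq => w /=.
  by rewrite (g1 _ w) // (g1 _ [::]).
apply: (virt_subS _ _ (sub_virt_sub G_subgroup (@subset_refl _ _))) => // y Gy.
pose f : {ffun 'I_k.+1 -> tree_aut d} :=
  [ffun l => if l == lift ord0 j then y else 1].
have f0 : f ord0 = 1 by rewrite ffunE.
exists f; split.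
- split; last by move=> l; rewrite ffunE; case: eqP => _ //; exact: subgroup1.
  by rewrite /preimage /= /ev f0; split=> //; exact: subgroup1.
- by rewrite /phi (unsplitK (inr j)) ffunE eqxx.
move=> l; have [l' ->] : exists l', l = unsplit l'.
  by exists (fintype.split l); rewrite splitK.
case: l' => l'; rewrite /phi unsplitK ?f0 ?tree_section_id // => ll.
rewrite ffunE (inj_eq lift_inj) ifN //.
by apply: contraNneq ll => ->.
Qed.

Lemma commensurable_direct_power_small (gT : groupType) (H : set gT) k : (2 <= d)%N ->
  (0 < k)%N -> commensurable H (direct_power G k) ->
  exists2 k', (1 <= k' <= d.-1)%N & commensurable H (direct_power G k').
Proof.
move=> d_ge2; elim/ltn_ind: k => k IHk k0 Hk.
have [small|large] := leqP k d.-1; first by exists k => //; rewrite k0.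
have d_gt0 := ltnW d_ge2.
have dk : (d <= k)%N by rewrite -(prednK d_gt0).
apply: (IHk (k - d).+1) => //.
  by rewrite -[X in (_ < X)%N](subnK dk) -addn1 ltn_add2l.
apply: commensurable_joint Hk _; have := commensurable_direct_power_shift (k - d).
by rewrite subnKC.
Qed.

End DirectPowers.

Theorem theorem1p2 (d : nat) (d_ge2 : (2 <= d)%N)
    (G : set (tree_aut d)) (G_subgroup : subgroup G)
    (G_fg : finitely_generated G) (G_selfrep : self_replicating G)
    (G_branch : branch G) (G_wsip : weak_subgroup_induction G)
    (H : set (tree_aut d)) (H_subgroup : subgroup H) (H_sub_G : H `<=` G)
    (H_fg : finitely_generated H) :
  commensurable H [set (1 : tree_aut d)] \/
  exists2 k : nat, (1 <= k <= d.-1)%N & commensurable H (direct_power G k).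
Proof.
have G_torsion := torsion_of_weak_subgroup_induction
  d_ge2 G_subgroup G_branch G_selfrep G_wsip.
have [n nP] := sections_dichotomy d_ge2 G_subgroup G_selfrep G_wsip
  H_subgroup H_sub_G H_fg.
set K := stab H (level n) in nP.
have sK : subgroup K by exact: subgroup_stab.
have KG : K `<=` G by move=> g [/H_sub_G].
have K_fix v : size v = n -> forall g, K g -> g v = v by move=> vn g [_]; apply.
have vK : virt_sub H K.
  exact: virt_sub_stab (sub_virt_sub H_subgroup (@subset_refl _ _)).
have [m [S [uS sS K1 KD]]] := isolated_sections d_ge2 G_subgroup G_fg G_selfrep
  G_branch G_torsion sK KG K_fix nP.
pose A1 := stab K [set` S].
have sA1 : subgroup A1 by exact: subgroup_stab.
have vA1 : virt_sub H A1.
  apply: virt_sub_trans vK _.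
  apply: virt_subS (virt_sub_stab m sK (sub_virt_sub sK (@subset_refl _ _))) => //.
  by move=> g [Kg gm]; split=> // v /= /sS; exact: gm.
have A1H : A1 `<=` H by move=> g [[]].
have A1_fix u g : u \in S -> A1 g -> g u = u by move=> uS' [_]; apply.
have [S0|S0] := posnP (size S).
  left; have A11 : A1 = [set 1].
    apply/seteqP; split=> [g [Kg _]|_ ->]; last exact: subgroup1.
    by apply: K1 => // u z; rewrite (size0nil S0).
  have s1 : subgroup [set (1 : tree_aut d)] by rewrite -A11.
  exists A1, [set 1]; split=> //; first exact/finite_index_virt_sub.
    by apply/finite_index_virt_sub => //; split=> //; exact: sub_virt_sub.
  exists id => //; rewrite A11; split=> //.
  by move=> x x1; exists x.
right; apply: (commensurable_direct_power_small G_subgroup G_selfrep G_branch d_ge2 S0).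
apply: (@commensurable_direct_power _ _ _ A1 _ _
  (fun i : 'I_(size S) => tree_section (tnth (in_tuple S) i))) => //.
- by move=> i x y _ Ay; apply: section_morph; apply: A1_fix Ay; exact: mem_tnth.
- move=> i x Ax; apply: section_in => //; first exact/H_sub_G/A1H.
  by apply: A1_fix Ax; exact: mem_tnth.
- move=> g Ag g1; apply: K1; first exact: Ag.1.
  move=> u z uS'; rewrite tree_sectionP (A1_fix u) //.
  by have /tnthP[i ->] : u \in in_tuple S by []; rewrite g1.
move=> i; set u := tnth _ i; have uS' : u \in S by exact: mem_tnth.
apply: virt_subS (KD u uS') => // x [k Kk [ku kS]].
have [ku0 kx] := tree_section_fix_uniq ku.
have k1 y : y \in S -> y != u -> k y = y /\ tree_section y k = 1.
  by move=> yS yu; apply: tree_section_fix_uniq; exact: kS.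
exists k; split.
- split=> // y yS; have [->//|yu] := eqVneq y u; exact: (k1 y yS yu).1.
- exact: kx.
move=> j ji; have jS : tnth (in_tuple S) j \in S by exact: mem_tnth.
have ju : tnth (in_tuple S) j != u.
  by rewrite /u !(tnth_nth [::]) nth_uniq.
exact: (k1 _ jS ju).2.
Qed.
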